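(* Let $n\ge3$, $b>0$, and let $0<s<\frac12$ be irrational. There are functions $K^{\pm}_{s,b}\in\mathcal{C}^\infty([0,\infty))$ such that, as $|x_n|+|x'|$ tends to zero with $|x_n|/|x'|$ bounded above, $$\frac{1}{|x'|^{\frac{n-3}{2}}}\int_0^\infty J_{\frac{n-3}{2}}(r|x'|)\,r^{\frac{n-1}{2}}e^{-r|x_n|}I^\pm_s(r,x_n)\,dr=\frac{K^\pm_{s,b}\left(\frac{|x_n|}{|x'|}\right)}{(x_n^2+|x'|^2)^{\frac{n-2+2s}{2}}}+O\left(\frac{1}{(|x_n|+|x'|)^{n-3+4s}}\right).$$
   Context: Here $(x',x_n)\in\mathbb{R}^{n-1}\times\mathbb{R}$ with $x_n\neq 0$, $J_\mu$ is the Bessel function of the first kind of order $\mu$, and for $r>0$ $$I^\pm_s(r,x_n)=4\pi\int_0^\infty\frac{\sin(\pi s)\,e^{-|x_n|\sigma}\,\sigma^s(\sigma+2r)^s}{|\sigma^s(\sigma+2r)^se^{\pi is}\mp b(\sigma+r)|^2}\,d\sigma$$ (the upper sign corresponds to $x_n>0$, the lower to $x_n<0$). *)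

(* Defs.v *)
From mathcomp Require Import all_boot all_order all_algebra.
From mathcomp Require Import complex.
From mathcomp Require Import all_classical all_reals all_analysis.
Set Implicit Arguments.
Unset Strict Implicit.
Unset Printing Implicit Defensive.
Import Order.TTheory GRing.Theory Num.Theory.
Import numFieldNormedType.Exports.
Local Open Scope classical_set_scope.
Local Open Scope ring_scope.

(* The library norm on 'rV_m is the sup norm, hence this definition. *)
Definition enorm (R : realType) (m : nat) (u : 'rV[R]_m) : R :=
  Num.sqrt (\sum_(i < m) u ord0 i ^+ 2).

(* Euler's integral; meaningful for a > 0. *)
Definition Gamma (R : realType) (a : R) : R :=
  \int[lebesgue_measure]_(t in `]0%R, +oo[) (t `^ (a - 1) * expR (- t)).

(* Power series of the Bessel function of the first kind of order mu,
   for mu > -1 and z > 0. *)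
Definition besselJ (R : realType) (mu z : R) : R :=
  limn (series (fun m : nat =>
    (-1) ^+ m / (m`!%:R * Gamma (m%:R + mu + 1)) * (z / 2) `^ (m%:R *+ 2 + mu))).

(* e^{i t} for real t *)
Definition expi (R : realType) (t : R) : R[i] := Complex (cos t) (sin t).

(* I^+_s for xn > 0 and I^-_s for xn < 0: the sign in front of b is -sgn(xn).
   [normc] is the real-valued complex modulus. *)
Definition Is (R : realType) (b s r xn : R) : R :=
  4 * pi * \int[lebesgue_measure]_(sigma in `]0%R, +oo[)
    (sin (pi * s) * expR (- `|xn| * sigma) * sigma `^ s * (sigma + 2 * r) `^ s
     / ComplexField.Normc.normc
         ((sigma `^ s * (sigma + 2 * r) `^ s)%:C%C * expi (pi * s)
          - (Num.sg xn * b * (sigma + r))%:C%C) ^+ 2).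

(* C^oo([0, +oo[): smooth on ]0, +oo[, continuous at 0, and every derivative
   has a finite limit at 0+. The values of f on ]-oo, 0[ play no role. *)
Definition smooth_nonneg (R : realType) (f : R -> R) : Prop :=
  f x @[x --> 0^'+] --> f 0 /\
  forall k : nat,
    {in `]0, +oo[, forall x : R, derivable (derive1n k f) x 1} /\
    cvg (derive1n k f x @[x --> 0^'+]).

(* Main.v *)
Require Import Defs.
From mathcomp Require Import all_boot all_order all_algebra.
From mathcomp Require Import complex.
From mathcomp Require Import all_classical all_reals all_analysis.
From mathcomp Require Import measurable_realfun.
From mathcomp Require Import ring lra.
Set Implicit Arguments.
Unset Strict Implicit.
Unset Printing Implicit Defensive.
Import Order.TTheory GRing.Theory Num.Theory.
Import numFieldNormedType.Exports.
Local Open Scope classical_set_scope.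
Local Open Scope ring_scope.

(** Why the theorem holds. Put [d = n - 2], [rho = |x'|], [t = |xn|].

    Reduction.  In [I_s] substitute [v = sigma * (sigma + 2 * r)], so that
    [sigma + r = sqrt y] with [y = v + r ^+ 2].  The two powers merge into
    [v `^ s], the exponential together with [e^{- r t}] becomes
    [e^{- t sqrt y}], and the squared modulus becomes
      [Q = b^2 y - 2 kap v^s sqrt y + v^{2 s}],  [kap = sgn xn * b * cos (pi s)],
    which is comparable to [y + v^{2 s}] because [|kap| < b] ([denom_lb]).  On the
    other side, the Bessel function of order [(d - 1) / 2] is a power times an
    entire function [P_d] of the squared argument ([besselJE]).  Hence the left
    side of the expansion is a constant times
      [int int r^d P_d (rho^2 r^2) v^s y^{-1/2} Q^{-1} e^{- t sqrt y} dr dv]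
    over the quadrant ([bessel_integralE]).

    Leading term.  For small [v^s / sqrt y], [1 / Q] is close to [b^{-2} / y].
    Replacing it leaves an integral that is homogeneous under
    [(r, v) -> (r / rho, v / rho^2)], hence equal to [rho^{- (d + 2 s)} F (t / rho)]
    ([main_integral_scale]); up to the factor [(1 + x^2)^{(d + 2 s) / 2}], [F] is the
    profile [K].  It does not see [kap], so one function serves both signs of
    [xn].  The error has the extra factor [v^s / sqrt y] in its integrand, which
    in the same scaling is worth [rho^{1 - 2 s}]: this is the order of the
    remainder.

    Uniformity.  The remaining point is that these integrals are bounded
    uniformly as the exponential rate tends to 0, where they do not converge
    absolutely and the oscillation of [P_d] has to be used.  With [v] fixed,
      [d/dr (r^{d+1} P_{d+2} (rho^2 r^2)) = (d + 1) r^d P_d (rho^2 r^2)],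
    so an integration by parts in [r] trades [P_d] for [P_{d+2}], which decays
    faster by one power of [rho r] ([bessel_entire_decay]), and a function of [y]
    for its derivative, which decays faster by one power of [y] (the symbol
    estimates of [symbol_std_symbol]).  After sufficiently many steps the
    integral converges absolutely with a constant independent of the rate, and
    scaling gives the power of [rho] ([radial_double_integral_bound]).

    This bound is used twice.  Applied to the error it gives [remainder_bound].
    Applied to the integrals with additional powers of [sqrt y], which are up
    to sign the derivatives of [F], it shows that all derivatives of [F] are
    bounded on the open half-line; therefore they all have limits at 0
    ([main_integral_cvg0]), and the profile is smooth up to the origin.
    Finally [|xn| + |x'|] is comparable to [rho] as long as [t / rho <= M]. *)

(** * Fundamental theorem of calculus on the open half-line *)

Section halfline_calculus.
Context {R : realType}.
Notation mu := (@lebesgue_measure R).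
Implicit Types (f F : R -> R).

Let cpt n : set R := `[n.+1%:R^-1, n.+1%:R]%classic.

Lemma halfline_bigcup :
  (`]0, +oo[%classic : set R) = \bigcup_n cpt n.
Proof.
apply/seteqP; split => x /=.
  rewrite in_itv/= andbT => x0.
  have [n nx] : exists n : nat, Num.max x x^-1 < n%:R.
    by eexists; exact: le_lt_trans (ler_norm _) (archi_boundP (normr_ge0 _)).
  move: nx; rewrite gt_max => /andP[xn xn'].
  exists n => //=; rewrite /cpt/= in_itv/=; apply/andP; split.
    rewrite -[x]invrK lef_pV2 ?posrE ?invr_gt0//.
    by rewrite (le_trans (ltW xn'))// ler_nat.
  by rewrite (le_trans (ltW xn))// ler_nat.
move=> [n _]; rewrite /cpt/= !in_itv/= andbT => /andP[+ _].
by apply: lt_le_trans; rewrite invr_gt0.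
Qed.

Lemma continuous_measurable_halfline f :
  (forall x : R, 0 < x -> {for x, continuous f}) -> measurable_fun (`]0%R, +oo[%classic : set R) f.
Proof.
move=> cf; apply: open_continuous_measurable_fun => //.
by move=> x; rewrite inE/= in_itv/= andbT => /cf.
Qed.

Lemma FTC2_compact f F (n : nat) :
  (forall x : R, 0 < x -> is_derive x 1 F (f x)) ->
  (forall x : R, 0 < x -> {for x, continuous f}) ->
  (\int[mu]_(x in cpt n) (f x)%:E =
    (F n.+1%:R - F n.+1%:R^-1)%:E)%E.
Proof.
move=> dF cf; rewrite /cpt; case: n => [|n].
  by rewrite invr1 set_itv1 integral_set1 subrr.
have n0 : 0 < n.+2%:R^-1 :> R by rewrite invr_gt0.
rewrite (@continuous_FTC2 _ f F)// ?EFinB//.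
- by rewrite (@lt_trans _ _ 1)// ?invf_lt1 ?ltr1n.
- apply: continuous_in_subspaceT => x; rewrite inE/= in_itv/= => /andP[xn _].
  by apply: cf; exact: lt_le_trans xn.
- have dFx (x : R) : 0 < x -> derivable F x 1 by move=> /dF [].
  have cF (x : R) : 0 < x -> F @ x --> F x.
    by move=> x0; apply: differentiable_continuous; exact/derivable1_diffP/dFx.
  split.
  + by move=> x; rewrite in_itv/= => /andP[xn _]; apply: dFx; exact: lt_trans xn.
  + by apply: cvg_at_right_filter; exact: cF.
  + by apply: cvg_at_left_filter; exact: cF.
- move=> x; rewrite in_itv/= => /andP[xn _].
  have [_] := dF _ (lt_trans n0 xn).
  by rewrite derive1E.
Qed.

Lemma cvg_ends F (l0 l : R) :
  F x @[x --> 0^'+] --> l0 -> F x @[x --> +oo] --> l ->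
  F n.+1%:R - F n.+1%:R^-1 @[n --> \oo] --> l - l0.
Proof.
move=> F0 Foo; apply: cvgB.
  apply: (cvg_comp (fun n : nat => n.+1%:R : R) F) Foo.
  by apply/cvgryPge => r; near=> n; rewrite (@le_trans _ _ n%:R)//;
    [near: n; exact: nbhs_infty_ger|rewrite ler_nat].
apply: (cvg_at_rightP F 0 l0).1 F0 _ _; split; first by move=> n; rewrite invr_gt0.
exact: (@cvg_harmonic R).
Unshelve. all: by end_near. Qed.

(** For a nonnegative integrand monotone convergence along compact intervals
    yields integrability together with the value; this is how the dominating
    kernels are shown to be integrable. *)
Lemma ge0_FTC_halfline f F (l0 l : R) :
  (forall x : R, 0 < x -> 0 <= f x) ->
  (forall x : R, 0 < x -> is_derive x 1 F (f x)) ->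
  (forall x : R, 0 < x -> {for x, continuous f}) ->
  F x @[x --> 0^'+] --> l0 -> F x @[x --> +oo] --> l ->
  (\int[mu]_(x in `]0%R, +oo[) (f x)%:E = (l - l0)%:E)%E.
Proof.
move=> f0 dF cf F0 Foo.
have mf := continuous_measurable_halfline cf.
rewrite halfline_bigcup.
have /cvg_lim <- // : (\int[mu]_(x in cpt n) (f x)%:E)%E
    @[n --> \oo] --> (\int[mu]_(x in \bigcup_n cpt n) (f x)%:E)%E.
  apply: ge0_nondecreasing_set_cvg_integral => //.
  - move=> m n mn; apply/subsetPset => x; rewrite /cpt/= !in_itv/= => /andP[a b].
    rewrite (le_trans _ a) ?lef_pV2 ?posrE ?ler_nat//=.
    by rewrite (le_trans b)// ler_nat.
  - by move=> n; exact: measurable_itv.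
  - move=> n; apply/measurable_EFinP; apply: measurable_funS mf => //.
    by rewrite halfline_bigcup => x nx; exists n.
  - move=> n x nx; rewrite lee_fin f0//.
    have : (`]0, +oo[%classic : set R) x by rewrite halfline_bigcup; exists n.
    by rewrite /= in_itv/= andbT.
under eq_fun do rewrite (FTC2_compact _ dF cf).
by apply/cvg_lim => //; apply: cvg_EFin; [exact: nearW|exact: cvg_ends].
Qed.

(** For a signed integrand the exhaustion is passed to the limit by dominated
    convergence, the integrand being its own bound. *)
Lemma FTC_halfline f F (l0 l : R) :
  mu.-integrable `]0, +oo[ (EFin \o f) ->
  (forall x : R, 0 < x -> is_derive x 1 F (f x)) ->
  (forall x : R, 0 < x -> {for x, continuous f}) ->
  F x @[x --> 0^'+] --> l0 -> F x @[x --> +oo] --> l ->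
  \int[mu]_(x in `]0, +oo[) f x = l - l0.
Proof.
move=> intf dF cf F0 Foo.
have mf := continuous_measurable_halfline cf.
pose D := cpt.
have DD n : D n `<=` `]0, +oo[ by rewrite halfline_bigcup => x nx; exists n.
have Dinc m n x : (m <= n)%N -> D m x -> D n x.
  move=> mn; rewrite /D /cpt/= !in_itv/= => /andP[a b].
  rewrite (le_trans _ a) ?lef_pV2 ?posrE ?ler_nat//=.
  by rewrite (le_trans b)// ler_nat.
rewrite /Rintegral.
have : (\int[mu]_(x in `]0%R, +oo[) ((f \_ (D n)) x)%:E)%E @[n --> \oo] -->
       (\int[mu]_(x in `]0%R, +oo[) (f x)%:E)%E.
  apply: (@dominated_cvg _ _ _ mu _ _ _ _ (fun x => `|(f x)%:E|)%E) => //.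
  - move=> n; apply/measurable_EFinP; apply: measurable_funTS.
    apply/(measurable_restrictT _ _).1; first exact: measurable_itv.
    by apply: measurable_funS mf => //; exact: DD.
  - move=> x; rewrite halfline_bigcup => -[N _ Nx].
    apply: cvg_near_cst; near=> n.
    rewrite patchE mem_set//; apply: (Dinc N) => //.
    by near: n; exact: nbhs_infty_ge.
  - exact: integrable_abse.
  - move=> n x _; rewrite patchE; case: ifPn => //.
    by rewrite abse0 abse_ge0.
move=> /cvg_lim <-//.
have -> : (fun n => \int[mu]_(x in `]0%R, +oo[) ((f \_ (D n)) x)%:E)%E =
   (fun n => (F n.+1%:R - F n.+1%:R^-1)%:E).
  apply/funext => n; rewrite -(FTC2_compact _ dF cf).
  rewrite -/(D n) -[in RHS](setIidr (DD n)) integral_mkcondr.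
  by apply: eq_integral => x _; rewrite !patchE; case: ifPn.
have /cvg_lim -> // : (F n.+1%:R - F n.+1%:R^-1)%:E @[n --> \oo] --> (l - l0)%:E.
by apply: cvg_EFin; [exact: nearW|exact: cvg_ends].
Unshelve. all: by end_near. Qed.

End halfline_calculus.

(** * Power and exponential kernels on the half-line *)

Section kernels.
Context {R : realType}.
Notation mu := (@lebesgue_measure R).

Lemma powRDp (a r s : R) : 0 < a -> a `^ (r + s) = a `^ r * a `^ s.
Proof. by move=> a0; rewrite powRD//; apply/implyP => _; rewrite gt_eqF. Qed.

Lemma continuous_powRp (a x : R) : 0 < x -> {for x, continuous (fun z : R => z `^ a)}.
Proof.
move=> x0; apply/differentiable_continuous/derivable1_diffP.
by case: (is_derive1_powR a x0).
Qed.

(** The comparison that produces every dominating function: [e^{tau (1 + z)}]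
    exceeds the term of degree [N.+1] of its Taylor series. *)
Lemma exp_dominates (N : nat) (tau : R) : 0 < tau ->
  exists2 C : R, 0 < C &
    forall z, 0 <= z -> (1 + z) ^+ N * expR (- (tau * z)) <= C.
Proof.
move=> tau0.
(* [expR tau] accounts for the shift from [z] to [1 + z]. *)
exists (N.+1`!%:R * tau ^- N.+1 * expR tau).
  by rewrite !mulr_gt0 ?invr_gt0 ?exprn_gt0 ?ltr0n ?fact_gt0 ?expR_gt0.
move=> z z0.
have z1 : 0 <= tau * (1 + z) by rewrite mulr_ge0 ?addr_ge0 ?(ltW tau0).
have h := expR_ge1Dxn N z1.
rewrite expRN ler_pdivrMr ?expR_gt0// -[leRHS]mulrA -expRD.
have -> : tau + tau * z = tau * (1 + z) by ring.
apply: (@le_trans _ _ ((1 + z) ^+ N.+1)).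
  by rewrite ler_weXn2l ?lerDl.
have f0 : N.+1`!%:R != 0 :> R by rewrite pnatr_eq0 -lt0n fact_gt0.
have -> : (1 + z) ^+ N.+1 = N.+1`!%:R * tau ^- N.+1 *
    ((tau * (1 + z)) ^+ N.+1 / N.+1`!%:R).
  by rewrite exprMn; field; rewrite f0 expf_neq0// gt_eqF.
rewrite ler_wpM2l ?mulr_ge0 ?invr_ge0 ?exprn_ge0 ?(ltW tau0)//.
by apply: le_trans h; rewrite lerDr.
Qed.

Lemma ge1_powR_le_exprn (a e : R) (N : nat) : 1 <= a -> e <= N%:R ->
  a `^ e <= a ^+ N.
Proof.
move=> a1 eN; rewrite -powR_mulrn; last exact: le_trans a1.
exact: ler_powR.
Qed.

(** This kernel behaves like [x `^ e] near 0 and like [x ^- 2] at infinity.  Among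
    the kernels that do so it has an elementary primitive, a power of
    [x / (1 + rho * x)], and its integral is an explicit power of [rho]. *)
Definition pow_kernel (e rho x : R) : R := (x / (1 + rho * x)) `^ e * (1 + rho * x) ^- 2.

Lemma pow_kernel_ge0 e rho x : 0 <= pow_kernel e rho x.
Proof. by rewrite mulr_ge0 ?powR_ge0// invr_ge0 sqr_ge0. Qed.

Lemma pow_kernelE (e rho x : R) : 0 < rho -> 0 < x ->
  pow_kernel e rho x = x `^ e * (1 + rho * x) `^ (- (e + 2)).
Proof.
move=> rho0 x0; have d0 : 0 < 1 + rho * x by rewrite addr_gt0 ?mulr_gt0.
rewrite /pow_kernel powRM ?invr_ge0 ?ltW// -mulrA opprD powRDp//.
by rewrite -powR_inv1 ?ltW// -powRrM mulN1r powR_invn ?ltW.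
Qed.

Lemma pow_kernel_lb (e rho x : R) (N : nat) : 0 < rho -> 0 < x -> e + 2 <= N%:R ->
  x `^ e * (1 + rho * x) ^- N <= pow_kernel e rho x.
Proof.
move=> rho0 x0 eN; rewrite pow_kernelE// ler_wpM2l ?powR_ge0//.
have d0 : 0 < 1 + rho * x by rewrite addr_gt0 ?mulr_gt0.
rewrite -powR_invn ?(ltW d0)// ler_powR// ?lerN2//.
by rewrite lerDl mulr_ge0// ltW.
Qed.

Lemma continuous_pow_kernel e rho (x : R) : 0 < rho -> 0 < x ->
  {for x, continuous (pow_kernel e rho)}.
Proof.
move=> rho0 x0.
have d0 : 0 < 1 + rho * x by rewrite addr_gt0 ?mulr_gt0.
have cd : {for x, continuous (fun z => 1 + rho * z)}.
  by apply: cvgD; [exact: cvg_cst|apply: cvgMr; exact: cvg_id].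
apply: cvgM.
  apply: (cvg_comp _ (fun z : R => z `^ e)); last first.
    by apply: continuous_powRp; exact: divr_gt0 x0 d0.
  by apply: cvgM; [exact: cvg_id|apply: cvgV => //; rewrite gt_eqF].
apply: cvgV; first by rewrite expf_eq0 gt_eqF.
by apply: (cvg_comp _ (fun z : R => z ^+ 2) cd); exact: exprn_continuous.
Qed.

Lemma integral_pow_kernel (e rho : R) : 0 < rho -> -1 < e ->
  (\int[mu]_(x in `]0%R, +oo[) (pow_kernel e rho x)%:E =
   (rho `^ (- (e + 1)) / (e + 1))%:E)%E.
Proof.
move=> rho0 e1.
have e10 : 0 < e + 1 by rewrite -ltrBlDr sub0r.
pose F (x : R) := (x / (1 + rho * x)) `^ (e + 1) / (e + 1).
have d0 (x : R) : 0 < x -> 0 < 1 + rho * x.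
  by move=> x0; rewrite addr_gt0 ?mulr_gt0.
have dF (x : R) : 0 < x -> is_derive x 1 F (pow_kernel e rho x).
  move=> x0.
  have h1 : is_derive x 1 (fun z : R => z / (1 + rho * z)) ((1 + rho * x) ^- 2).
    have hd : 1 + rho * x != 0 by rewrite gt_eqF// d0.
    apply: is_derive_eq; rewrite /GRing.scale /=; by field.
  have q0 : 0 < x / (1 + rho * x) by rewrite divr_gt0// d0.
  have h2 := is_derive1_powR (e + 1) q0.
  have h3 := @is_derive1_comp R (fun z : R => z `^ (e + 1)) (fun z : R => z / (1 + rho * z)) x _ _ h2 h1.
  rewrite /F.
  apply: is_derive_eq; rewrite /GRing.scale /= /pow_kernel addrK.
  by field; rewrite !gt_eqF// d0.
rewrite -[rho `^ _ / _]subr0.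
apply: (ge0_FTC_halfline _ dF).
- by move=> x _; exact: pow_kernel_ge0.
- by move=> x x0; exact: continuous_pow_kernel.
- rewrite -[X in _ --> X](mul0r (e + 1)^-1).
  apply: cvgMl.
  apply/cvg_at_rightP => u [u0 ucv].
  apply: ((cvg_at_rightP (fun z : R => z `^ (e + 1)) 0 0).1 _
    (fun n => u n / (1 + rho * u n))); first exact: powR_cvg0.
  split; first by move=> n; apply: divr_gt0 => //; exact: d0.
  rewrite -[X in _ --> X](mul0r (1 + rho * 0)^-1).
  apply: cvgM => //; apply: cvgV; first by rewrite mulr0 addr0.
  by apply: cvgD; [exact: cvg_cst|apply: cvgMr].
- apply: cvgMl; rewrite powRN -powR_inv1 ?powR_ge0//.
  rewrite -powRrM mulrC powRrM powR_inv1 ?(ltW rho0)//.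
  apply: (cvg_comp (fun x => x / (1 + rho * x)) (fun z : R => z `^ (e + 1))); last first.
    by apply: continuous_powRp; rewrite invr_gt0.
  apply: (@cvg_trans _ ((x^-1 + rho)^-1 @[x --> +oo])).
    apply: near_eq_cvg; near=> x.
    have x0 : 0 < x by [].
    have := d0 _ x0; move: (x0) => /gt_eqF xn /gt_eqF dn.
    by field; rewrite xn dn.
  apply: cvgV; first by rewrite gt_eqF.
  rewrite -[X in _ --> X]add0r; apply: cvgD; last exact: cvg_cst.
  by apply/gtr0_cvgV0 => //; exact: nbhs_pinfty_gt.
Unshelve. all: by end_near. Qed.

Lemma powRN_cvgy (a : R) : 0 < a -> x `^ (- a) @[x --> +oo] --> 0.
Proof.
move=> a0; apply/cvgr0Pnorm_lt => /= eps eps0.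
near=> x.
have x0 : 0 < x by [].
rewrite ger0_norm ?powR_ge0// powRN invf_plt ?posrE ?powR_gt0//.
have -> : eps^-1 = (eps^-1 `^ a^-1) `^ a.
  by rewrite -powRrM mulVf ?gt_eqF// powRr1// invr_ge0 ltW.
rewrite gt0_ltr_powR// ?nnegrE ?powR_ge0 ?ltW//.
Unshelve. all: by end_near. Qed.

Lemma integral_powR_shift (c w : R) : 1 < c -> 0 < w ->
  (\int[mu]_(v in `]0%R, +oo[) ((v + w) `^ (- c))%:E =
   (w `^ (1 - c) / (c - 1))%:E)%E.
Proof.
move=> c1 w0.
have c10 : 0 < c - 1 by rewrite subr_gt0.
pose F (v : R) := - ((v + w) `^ (1 - c) / (c - 1)).
have dF (v : R) : 0 < v -> is_derive v 1 F ((v + w) `^ (- c)).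
  move=> v0; have vw : 0 < v + w by rewrite addr_gt0.
  have h1 : is_derive v 1 (fun z : R => z + w) 1.
    by apply: is_derive_eq; rewrite addr0.
  have h2 := is_derive1_powR (1 - c) vw.
  have h3 := @is_derive1_comp R (fun z : R => z `^ (1 - c)) (fun z : R => z + w) v _ _ h2 h1.
  rewrite /F.
  apply: is_derive_eq; rewrite /GRing.scale /=.
  rewrite (_ : 1 - c - 1 = - c); last by ring.
  by field; rewrite gt_eqF.
rewrite -[w `^ _ / _]add0r -[w `^ _ / _]opprK.
apply: (ge0_FTC_halfline _ dF).
- by move=> x _; exact: powR_ge0.
- move=> v v0; apply: (cvg_comp (fun z : R => z + w) (fun z : R => z `^ (- c))).
    by apply: cvgD; [exact: cvg_id|exact: cvg_cst].
  by apply: continuous_powRp; rewrite addr_gt0.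
- apply: cvgN; apply: cvgMl; apply: cvg_at_right_filter.
  apply: (cvg_comp (fun z : R => z + w) (fun z : R => z `^ (1 - c)) (G := nbhs w)); last first.
    exact: continuous_powRp.
  have h : z + w @[z --> (0 : R)] --> 0 + w by apply: cvgD; [exact: cvg_id|exact: cvg_cst].
  by rewrite add0r in h; exact: h.
- rewrite -oppr0 -[X in _ --> - X](mul0r (c - 1)^-1).
  apply: cvgN; apply: cvgMl.
  apply: (cvg_comp (fun z : R => z + w) (fun z : R => z `^ (1 - c)) (G := +oo)).
    exact: cvg_addrr.
  by rewrite -opprB; exact: powRN_cvgy.
Qed.

Lemma integrable_halfline (f : R -> R) (C e rho : R) : 0 < rho -> -1 < e ->
  measurable_fun (`]0%R, +oo[%classic : set R) f ->
  (forall x : R, 0 < x -> `|f x| <= C * pow_kernel e rho x) ->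
  mu.-integrable `]0, +oo[ (EFin \o f).
Proof.
move=> rho0 e1 mf fC.
have mrk : measurable_fun (`]0%R, +oo[%classic : set R) (pow_kernel e rho).
  by apply: continuous_measurable_halfline => x x0; exact: continuous_pow_kernel.
apply: (@le_integrable _ _ _ mu _ _ (EFin \o f) (fun x => C%:E * (pow_kernel e rho x)%:E)%E) => //.
- exact/measurable_EFinP.
- move=> x; rewrite /= in_itv/= andbT => x0.
  by rewrite lee_fin (le_trans (fC _ x0))// ler_norm.
- apply: integrableZl => //; apply/integrableP; split.
    exact/measurable_EFinP.
  under eq_integral do rewrite /= ger0_norm ?pow_kernel_ge0//.
  by rewrite integral_pow_kernel// ltry.
Qed.

End kernels.

(** * The entire function behind the Bessel function *)

Section bessel_series.
Context {R : realType}.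

(** [bessel_entire d (z ^+ 2)] is the Bessel function of order [(d - 1) / 2] at [z],
    divided by its leading power and normalised to be 1 at the origin.  Writing
    [m! * 2 ^ m * (d + 1) * (d + 3) * ... * (d + 2 m - 1)] for the denominators keeps
    the Gamma function out of the recurrences. *)
Definition bessel_coef (d m : nat) : R :=
  (-1) ^+ m / (2 ^ m * m`! * \prod_(i < m) (d + (2 * i).+1))%N%:R.

Definition bessel_entire (d : nat) (w : R) : R := limn (pseries (bessel_coef d) w).

Lemma bessel_coef_den_gt0 d m : (0 < 2 ^ m * m`! * \prod_(i < m) (d + (2 * i).+1))%N.
Proof.
rewrite !muln_gt0 expn_gt0 fact_gt0 /=.
by apply: prodn_gt0 => i; rewrite addnS.
Qed.

Lemma bessel_coef_le d m : `|bessel_coef d m| <= (m`!%:R)^-1.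
Proof.
rewrite normrM normrX normrN1 expr1n mul1r normfV ger0_norm//.
rewrite lef_pV2 ?posrE ?ltr0n ?bessel_coef_den_gt0 ?fact_gt0// ler_nat.
rewrite mulnAC -[leqLHS]mul1n leq_mul// muln_gt0 expn_gt0/=.
by have := bessel_coef_den_gt0 d m; rewrite !muln_gt0 => /andP[].
Qed.

Lemma is_cvg_bessel_coef d (w : R) : cvgn (pseries (bessel_coef d) w).
Proof.
apply: normed_cvg.
have h n : 0 <= exp_coeff `|w| n by rewrite exp_coeff_ge0.
apply: series_le_cvg h _ _ => [n|n|]; first exact: normr_ge0.
  rewrite /= normrM /exp_coeff /= mulrC normrX ler_wpM2l ?exprn_ge0//.
  exact: bessel_coef_le.
exact: is_cvg_series_exp_coeff.
Qed.

Lemma bessel_coefS d m : m.+1%:R * bessel_coef d m.+1 = - (2 * d.+1%:R)^-1 * bessel_coef d.+2 m.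
Proof.
rewrite /bessel_coef big_ord_recl /= muln0 addn1 exprS factS expnS.
under eq_bigr => i _.
  rewrite /bump /= mulnDr muln1 (_ : (d + _)%N = (d.+2 + (2 * i).+1)%N); last first.
    by rewrite !(addSn, addnS, add0n).
  over.
rewrite /= !natrM !natrX.
set p := (\prod_(i < m) _)%N.
have p0 : (0 < p)%N.
  by have := bessel_coef_den_gt0 d.+2 m; rewrite !muln_gt0 => /andP[].
field.
rewrite !pnatr_eq0 -!lt0n p0 fact_gt0 /=.
by rewrite expf_eq0 pnatr_eq0 andbF /= ![1 + _]addrC !natr1 !pnatr_eq0.
Qed.

Lemma bessel_coef_rec d m :
  bessel_coef d m = bessel_coef d.+2 m + 2 / d.+1%:R * (m%:R * bessel_coef d.+2 m).
Proof.
have e : ((\prod_(i < m) (d + (2 * i).+1)) * (d + (2 * m).+1)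
    = d.+1 * \prod_(i < m) (d.+2 + (2 * i).+1))%N.
  rewrite -(@big_ord_recr _ _ _ m (fun i => d + (2 * i).+1)%N).
  rewrite big_ord_recl /= muln0 addn1; congr (_ * _)%N.
  by apply: eq_bigr => i _; rewrite /bump /= mulnDr muln1 !(addSn, addnS, add0n).
have := bessel_coef_den_gt0 d m; have := bessel_coef_den_gt0 d.+2 m.
rewrite /bessel_coef !muln_gt0 !natrM !natrX.
set p := (\prod_(i < m) _)%N in e *; set q := (\prod_(i < m) _)%N in e *.
move=> /andP[_ q0] /andP[/andP[_ _] p0].
move: e => /(congr1 (fun x => x%:R : R)); 
rewrite !natrM -[(2 * m).+1]addn1 (natrD _ d) (natrD _ (2 * m)) natrM => e.
have -> : p%:R = d.+1%:R * q%:R / (d%:R + (2%:R * m%:R + 1)) :> R.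
  by rewrite -e mulfK// -natrM natr1 -natrD pnatr_eq0 -lt0n addnS.
field.
rewrite !pnatr_eq0 -!lt0n q0 fact_gt0 expf_eq0 pnatr_eq0 andbF /=.
have -> : d%:R + (2 * m%:R + 1) = (d + (2 * m).+1)%:R :> R.
  by rewrite -[(2 * m).+1]addn1 (natrD _ d) (natrD _ (2 * m)) natrM.
by rewrite ?[1 + _]addrC ?natr1 !pnatr_eq0 !addnS.
Qed.

Lemma bessel_coef_diffs d :
  pseries_diffs (bessel_coef d) = (fun m => - (2 * d.+1%:R)^-1 * bessel_coef d.+2 m).
Proof. by apply/funext => m; rewrite /pseries_diffs bessel_coefS. Qed.

Lemma cvg_pseriesZ (k : R) (c : R^nat) (w : R) : cvgn (pseries c w) ->
  pseries (fun m => k * c m) w @ \oo --> k * limn (pseries c w).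
Proof.
move=> cc.
have -> : pseries (fun m => k * c m) w = (fun n => k * pseries c w n).
  apply/funext => n; rewrite /pseries /series /= mulr_sumr.
  by apply: eq_bigr => i _; rewrite mulrA.
exact: cvgMr.
Qed.

Lemma cvg_bessel_coef_diffs d (w : R) :
  pseries (pseries_diffs (bessel_coef d)) w @ \oo -->
    - (2 * d.+1%:R)^-1 * bessel_entire d.+2 w.
Proof. by rewrite bessel_coef_diffs; apply: cvg_pseriesZ; exact: is_cvg_bessel_coef. Qed.

Lemma is_derive_bessel_entire d (w : R) :
  is_derive w 1 (bessel_entire d) (- (2 * d.+1%:R)^-1 * bessel_entire d.+2 w).
Proof.
have <- : limn (pseries (pseries_diffs (bessel_coef d)) w) =
    - (2 * d.+1%:R)^-1 * bessel_entire d.+2 w.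
  by apply/cvg_lim => //; exact: cvg_bessel_coef_diffs.
apply: (@pseries_snd_diffs _ _ (`|w| + 1)).
- exact: is_cvg_bessel_coef.
- by apply/cvg_ex; eexists; exact: cvg_bessel_coef_diffs.
- rewrite bessel_coef_diffs.
  have -> : pseries_diffs (fun m => - (2 * d.+1%:R)^-1 * bessel_coef d.+2 m) =
      (fun m => - (2 * d.+1%:R)^-1 * pseries_diffs (bessel_coef d.+2) m).
    by apply/funext => m; rewrite /pseries_diffs mulrCA.
  apply/cvg_ex; eexists; apply: cvg_pseriesZ.
  by apply/cvg_ex; eexists; exact: cvg_bessel_coef_diffs.
- by rewrite [ltRHS]ger0_norm ?ltrDl// addr_ge0.
Qed.

Lemma continuous_bessel_entire d : continuous (@bessel_entire d).
Proof.
by move=> w; apply/differentiable_continuous/derivable1_diffP; case: (is_derive_bessel_entire d w).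
Qed.

Lemma bessel_entire0 d : bessel_entire d 0 = 1.
Proof.
apply/cvg_lim => //; rewrite -cvg_shiftS /=.
apply: cvg_near_cst; apply: nearW => n.
rewrite /pseries /series /= big_nat_recl//= big1 => [|i _].
  by rewrite /bessel_coef big_ord0 expr0 muln1 expn0 fact0 !mulr1 divr1 addr0.
by rewrite expr0n mulr0.
Qed.

(** The contiguity relation between Bessel functions of orders differing by
    one unit. *)
Lemma bessel_entire_rec d (w : R) :
  bessel_entire d w = bessel_entire d.+2 w - w / (d.+1%:R * d.+3%:R) * bessel_entire d.+4 w.
Proof.
apply/cvg_lim => //.
have -> : pseries (bessel_coef d) w = (fun n => pseries (bessel_coef d.+2) w n +
    2 / d.+1%:R * w * series (fun m => m%:R * bessel_coef d.+2 m * w ^+ m.-1) n).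
  apply/funext => n; rewrite /pseries /series /= mulr_sumr -big_split /=.
  apply: eq_bigr => -[|m] _; rewrite bessel_coef_rec.
    by rewrite mulr0n !mul0r !mulr0 !addr0.
  by rewrite /= exprS; ring.
have -> : bessel_entire d.+2 w - w / (d.+1%:R * d.+3%:R) * bessel_entire d.+4 w =
    bessel_entire d.+2 w + 2 / d.+1%:R * w * (- (2 * d.+3%:R)^-1 * bessel_entire d.+4 w).
  by field; rewrite ?andbT; do ?[apply/andP; split]; rewrite gt_eqF// ltr_pwDl.
apply: cvgD; first exact: is_cvg_bessel_coef.
apply: cvgMr.
have h := @cvg_bessel_coef_diffs d.+2 w.
rewrite -(cvg_lim _ h)//.
apply: pseries_diffs_equiv.
by apply/cvg_ex; eexists; exact: h.
Qed.

(** The energy of the Bessel differential equation, [f ^+ 2] plus the squared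
    derivative of [f] in the unsquared variable [sqrt w], is nonincreasing: its
    derivative is [- d] times a square by [bessel_entire_rec].  This bounds both
    [bessel_entire d] and, with decay [1 / sqrt w], [bessel_entire d.+2]. *)
Lemma bessel_entire_energy d (w : R) : 0 <= w ->
  bessel_entire d w ^+ 2 + w / d.+1%:R ^+ 2 * bessel_entire d.+2 w ^+ 2 <= 1.
Proof.
move=> w0.
pose E (x : R) := bessel_entire d x ^+ 2 + x / d.+1%:R ^+ 2 * bessel_entire d.+2 x ^+ 2.
have dE (x : R) : is_derive x 1 E (- d%:R * (d.+1%:R^-1 * bessel_entire d.+2 x) ^+ 2).
  have h0 := is_derive_bessel_entire d x; have h1 := is_derive_bessel_entire d.+2 x.
  rewrite /E.
  apply: is_derive_eq.
  rewrite /GRing.scale /= bessel_entire_rec.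
  field.
  by rewrite ?andbT; do ?[apply/andP; split]; rewrite gt_eqF// ltr_pwDl.
have E0 : E 0 = 1 by rewrite /E bessel_entire0 !mul0r addr0 expr1n.
rewrite -[leLHS]/(E w) -[leRHS]E0.
apply: (@ler0_derive1_le_cc _ E 0 w) => //.
- by move=> x _; rewrite derive1E derive_val mulNr oppr_le0 mulr_ge0// sqr_ge0.
- apply: derivable_within_continuous => x _; by case: (dE x).
- by rewrite in_itv/= w0 lexx.
- by rewrite in_itv/= lexx.
Qed.

Lemma bessel_entire_le1 d (w : R) : 0 <= w -> `|bessel_entire d w| <= 1.
Proof.
move=> w0; rewrite -(@ler_pXn2r _ 2)// ?nnegrE// expr1n real_normK ?num_real//.
by apply: le_trans (bessel_entire_energy d w0); rewrite lerDl mulr_ge0 ?sqr_ge0// divr_ge0// sqr_ge0.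
Qed.

Lemma bessel_entire_sqrt_le d (w : R) : 0 <= w ->
  Num.sqrt w * `|bessel_entire d.+2 w| <= d.+1%:R.
Proof.
move=> w0; rewrite -(@ler_pXn2r _ 2)// ?nnegrE ?mulr_ge0 ?sqrtr_ge0//.
rewrite exprMn sqr_sqrtr// real_normK ?num_real//.
have := le_trans _ (bessel_entire_energy d w0) => /(_ (w / d.+1%:R ^+ 2 * bessel_entire d.+2 w ^+ 2)).
rewrite lerDr sqr_ge0 => /(_ isT).
by rewrite mulrAC ler_pdivrMr ?mul1r// exprn_gt0.
Qed.

(** Each increase of [d] by two gains one power of [1 / sqrt w].  The energy gives
    the cases [N = 0, 1]; the recurrence expresses [w * bessel_entire d.+4] by the
    two preceding functions, so the induction carries two consecutive bounds. *)
Lemma bessel_entire_decay d N : exists2 C : R, 0 < C & forall w : R, 0 <= w ->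
  (1 + Num.sqrt w) ^+ N * `|bessel_entire (d + 2 * N) w| <= C.
Proof.
suff [C [C' [C0 C'0 h _]]] : exists C C' : R, [/\ 0 < C, 0 < C',
    forall w : R, 0 <= w -> (1 + Num.sqrt w) ^+ N * `|bessel_entire (d + 2 * N) w| <= C &
    forall w : R, 0 <= w ->
      (1 + Num.sqrt w) ^+ N.+1 * `|bessel_entire (d + 2 * N.+1) w| <= C'] by exists C.
elim: N => [|N [C [C' [C0 C'0 h h']]]].
  exists 1, (1 + d.+1%:R); split => //.
  - by move=> w w0; rewrite muln0 addn0 expr0 mul1r bessel_entire_le1.
  - move=> w w0; rewrite muln1 addn2 expr1 mulrDl mul1r lerD//.
      exact: bessel_entire_le1.
    exact: bessel_entire_sqrt_le.
pose e := (d + 2 * N)%N.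
have e1 : (d + 2 * N.+1)%N = e.+2 by rewrite mulnS addnCA addSn add1n.
have e2 : (d + 2 * N.+2)%N = e.+4 by rewrite mulnS addnCA e1 addSn add1n.
rewrite e1 e2 -/e in h h' *.
pose K : R := e.+1%:R * e.+3%:R.
have K0 : 0 < K by rewrite mulr_gt0.
exists C', (2 ^+ N.+2 + 4 * K * (C + C')); split => //.
  by rewrite addr_gt0 ?exprn_gt0// mulr_gt0 ?mulr_gt0 ?addr_gt0.
move=> w w0; set q := Num.sqrt w.
have q0 : 0 <= q by exact: sqrtr_ge0.
(* For [q <= 1] the uniform bound [1] suffices; for [q >= 1] the recurrence is
   divided by [w], which is at least [(1 + q) ^+ 2 / 4]. *)
have [q1|q1] := leP q 1.
  rewrite -[leLHS]addr0 lerD//; last first.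
    by rewrite mulr_ge0 ?addr_ge0 ?mulr_ge0 ?ltW.
  rewrite -[leRHS]mulr1 ler_pM ?exprn_ge0 ?addr_ge0 ?bessel_entire_le1//.
  by rewrite lerXn2r ?nnegrE ?addr_ge0// (_ : 2 = 1 + 1) ?lerD2l.
rewrite (le_trans (_ : _ <= 4 * K * (C + C')))// ?lerDr ?exprn_ge0//.
have wE : w = q ^+ 2 by rewrite sqr_sqrtr.
have PE : w * bessel_entire e.+4 w = K * (bessel_entire e.+2 w - bessel_entire e w).
  rewrite (bessel_entire_rec e) /K; field.
  by rewrite ?andbT; do ?[apply/andP; split]; rewrite gt_eqF// ltr_pwDl.
have hq : (1 + q) ^+ 2 <= 4 * w by rewrite wE; nra.
rewrite 2!exprS mulrA -expr2 -mulrA.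
apply: le_trans (ler_wpM2r _ hq) _.
  by rewrite mulr_ge0 ?exprn_ge0 ?addr_ge0.
have -> : 4 * w * ((1 + q) ^+ N * `|bessel_entire e.+4 w|) =
    4 * ((1 + q) ^+ N * `|w * bessel_entire e.+4 w|).
  by rewrite normrM (ger0_norm w0); ring.
rewrite -mulrA ler_wpM2l// PE normrM (ger0_norm (ltW K0)) mulrCA ler_wpM2l ?(ltW K0)//.
apply: le_trans (ler_wpM2l _ (ler_normB _ _)) _.
  by rewrite exprn_ge0 ?addr_ge0.
rewrite mulrDr addrC lerD ?h//.
apply: le_trans (h' _ w0); rewrite exprS -mulrA.
by rewrite ler_peMl ?lerDl// mulr_ge0 ?exprn_ge0 ?addr_ge0.
Qed.

End bessel_series.

(** * Gamma function and Bessel functions of order (d - 1) / 2 *)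

Section gamma_bessel.
Context {R : realType}.
Notation mu := (@lebesgue_measure R).

Lemma powR_exp_le_pow_kernel (e tau : R) : 0 < tau -> exists2 C : R, 0 < C &
  forall x, 0 < x -> x `^ e * expR (- (tau * x)) <= C * pow_kernel e 1 x.
Proof.
move=> tau0.
have [N eN] : exists N : nat, e + 2 <= N%:R.
  by eexists; rewrite ltW//; exact: le_lt_trans (ler_norm _) (archi_boundP (normr_ge0 _)).
have [C C0 CN] := exp_dominates N tau0.
exists C => // x x0.
apply: (@le_trans _ _ (C * (x `^ e * (1 + 1 * x) ^- N))); last first.
  by rewrite ler_wpM2l ?(ltW C0)// pow_kernel_lb.
rewrite mulrCA ler_wpM2l ?powR_ge0// mul1r ler_pdivlMr ?exprn_gt0 ?addr_gt0//.
by rewrite mulrC CN// ltW.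
Qed.

Lemma cvgy0_le_inv (F : R -> R) (C : R) :
  (forall x, 1 <= x -> `|F x| <= C * x^-1) -> F x @[x --> +oo] --> 0.
Proof.
move=> FC.
have FC0 : (C * x^-1) @[x --> +oo] --> 0.
  rewrite -[X in _ --> X](mulr0 C); apply: cvgMr.
  by apply/gtr0_cvgV0 => //; exact: nbhs_pinfty_gt.
apply: norm_cvg0; apply: (squeeze_cvgr _ (cvg_cst 0) FC0).
by near=> x; rewrite normr_ge0 FC//; near: x; exact: nbhs_pinfty_ge.
Unshelve. all: by end_near. Qed.

Lemma powR_exp_cvgy (a tau : R) : 0 < tau ->
  x `^ a * expR (- (tau * x)) @[x --> +oo] --> 0.
Proof.
move=> tau0.
have [N aN] : exists N : nat, a <= N%:R.
  by eexists; rewrite ltW//; exact: le_lt_trans (ler_norm _) (archi_boundP (normr_ge0 _)).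
have [C C0 CN] := exp_dominates N.+1 tau0.
apply: (@cvgy0_le_inv _ C) => x x1.
have x0 : 0 < x by exact: lt_le_trans x1.
rewrite ger0_norm ?mulr_ge0 ?powR_ge0 ?expR_ge0//.
rewrite ler_pdivlMr//; apply: le_trans (CN x (ltW x0)).
rewrite mulrAC ler_wpM2r ?expR_ge0// exprSr ler_pM ?powR_ge0 ?(ltW x0) ?lerDr//.
apply: (@le_trans _ _ (x ^+ N)); first exact: ge1_powR_le_exprn.
by rewrite lerXn2r ?nnegrE ?addr_ge0 ?(ltW x0)// lerDr.
Qed.

Lemma continuous_powR_exp (e tau x : R) : 0 < x ->
  {for x, continuous (fun z : R => z `^ e * expR (- (tau * z)))}.
Proof.
move=> x0; apply: cvgM; first exact: continuous_powRp.
apply: continuous_cvg; first exact: continuous_expR.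
by apply: cvgN; apply: cvgMr; exact: cvg_id.
Qed.

Lemma integrable_powR_exp (e : R) : -1 < e ->
  mu.-integrable `]0, +oo[ (EFin \o (fun z : R => z `^ e * expR (- (1 * z)))).
Proof.
move=> e1; have [C C0 CN] := powR_exp_le_pow_kernel e (@ltr01 R).
apply: (@integrable_halfline _ _ C e 1) => //.
  by apply: continuous_measurable_halfline => x; exact: continuous_powR_exp.
move=> x x0; rewrite ger0_norm ?mulr_ge0 ?powR_ge0 ?expR_ge0//.
exact: CN.
Qed.

(** Integration by parts, that is, the vanishing of the integral of the
    derivative of [- t `^ a * e^{-t}]. *)
Lemma Gamma_rec (a : R) : 0 < a -> Gamma (a + 1) = a * Gamma a.
Proof.
move=> a0.
pose g (e z : R) := z `^ e * expR (- (1 * z)).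
have GE (c : R) : Gamma c = \int[mu]_(t in `]0%R, +oo[) g (c - 1) t.
  by apply: eq_Rintegral => t _; rewrite /g mul1r.
have i0 : mu.-integrable `]0, +oo[ (EFin \o g (a - 1)).
  by apply: integrable_powR_exp; rewrite ltrBrDl subrr.
have i1 : mu.-integrable `]0, +oo[ (EFin \o g a).
  by apply: integrable_powR_exp; rewrite (lt_trans _ a0)// ltrN10.
rewrite !GE addrK -RintegralZl//.
apply/eqP; rewrite -subr_eq0 -RintegralB//; last first.
  rewrite (_ : _ \o _ = (fun x => a%:E * (g (a - 1) x)%:E)%E)//.
  exact: integrableZl.
have dF (x : R) : 0 < x -> is_derive x 1 (fun z => - g a z) (g a x - a * g (a - 1) x).
  move=> x0; have h := is_derive1_powR a x0.
  rewrite /g; apply: is_derive_eq; rewrite /GRing.scale /= mulr1; ring.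
apply/eqP; rewrite -[RHS](subrr 0).
apply: (FTC_halfline _ dF).
- rewrite (_ : _ \o _ = (fun x => (g a x)%:E - a%:E * (g (a - 1) x)%:E)%E)//.
  by apply: integrableB => //; exact: integrableZl.
- move=> x x0; apply: cvgB; first exact: continuous_powR_exp.
  by apply: cvgMr; exact: continuous_powR_exp.
- rewrite -[X in _ --> X]oppr0; apply: cvgN; rewrite -[X in _ --> X](mul0r (expR (- (1 * 0)))).
  apply: cvgM; first exact: powR_cvg0.
  apply: cvg_at_right_filter; apply: continuous_cvg; first exact: continuous_expR.
  by apply: cvgN; apply: cvgMr; exact: cvg_id.
- by rewrite -[X in _ --> X]oppr0; apply: cvgN; exact: powR_exp_cvgy.
Qed.

Lemma Gamma_prod (a : R) (m : nat) : 0 < a ->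
  Gamma (m%:R + a) = (\prod_(i < m) (a + i%:R)) * Gamma a.
Proof.
move=> a0; elim: m => [|m IH]; first by rewrite big_ord0 mul1r add0r.
have ma0 : 0 < m%:R + a by rewrite ltr_wpDl.
rewrite -natr1 addrAC (Gamma_rec ma0) IH big_ord_recr /= mulrA.
by rewrite [m%:R + a]addrC [X in X * _]mulrC.
Qed.

(** Termwise comparison of the two series: [Gamma (m + nu + 1)] is
    [Gamma (nu + 1)] times a product of [m] multiples of 1/2 by [Gamma_prod]. *)
Lemma besselJE (d : nat) (z : R) : (0 < d)%N -> 0 < z ->
  besselJ ((d%:R - 1) / 2) z =
  (z / 2) `^ ((d%:R - 1) / 2) / Gamma ((d%:R - 1) / 2 + 1) * bessel_entire d (z ^+ 2).
Proof.
move=> d0 z0; set nu := (d%:R - 1) / 2.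
have nu0 : 0 <= nu by rewrite divr_ge0// subr_ge0 ler1n.
have nu1 : 0 < nu + 1 by rewrite ltr_wpDl.
have z20 : 0 < z / 2 by rewrite divr_gt0.
apply/cvg_lim => //.
have := @cvg_pseriesZ R ((z / 2) `^ nu / Gamma (nu + 1)) _ _ (@is_cvg_bessel_coef R d (z ^+ 2)).
apply: cvg_trans; apply: near_eq_cvg; apply: nearW => n.
rewrite /pseries /series /=; apply: eq_bigr => m _.
have -> : m%:R *+ 2 = (2 * m)%:R :> R by rewrite natrM mulr_natl.
rewrite -addrA Gamma_prod// powRDp// powR_mulrn ?(ltW z20)//.
rewrite /bessel_coef !natrM natrX natr_prod.
have -> : \prod_(i < m) (nu + 1 + i%:R) =
    2 ^- m * \prod_(i < m) (d + (2 * i).+1)%:R :> R.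
  elim: m => [|m IH]; first by rewrite !big_ord0 expr0 invr1 mul1r.
  rewrite !big_ord_recr /= IH exprS invfM.
  rewrite -[(2 * m).+1]addn1 (natrD _ d) (natrD _ (2 * m)) natrM /nu.
  by field.
rewrite !exprM expr_div_n [(z ^+ 2 / _) ^+ m]expr_div_n.
have -> : (2 : R) ^+ 2 ^+ m = 2 ^+ m * 2 ^+ m by rewrite -exprMn expr2.
set p := \prod_(i < m) _; set q := (z / 2) `^ nu; set zz := _ ^+ m.
have p0 : p != 0.
  by apply/prodf_neq0 => i _; rewrite pnatr_eq0 addnS.
have f0 : m`!%:R != 0 :> R by rewrite pnatr_eq0 -lt0n fact_gt0.
have t0 : 2 ^+ m != 0 :> R by rewrite expf_neq0.
(* In the degenerate case both sides vanish by the convention [0^-1 = 0]; this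
   avoids proving that [Gamma] is positive. *)
have [->|G0] := eqVneq (Gamma (nu + 1)) 0.
  by rewrite !(invr0, mulr0, mul0r).
by field; rewrite G0 p0 f0 t0.
Qed.

End gamma_bessel.

(** * Symbol estimates for the denominator *)

Section symbols.
Context {R : realType}.

(** Symbols of order [beta] with exponential decay of rate [tau] in [sqrt y]: each
    derivative lowers the order by one.  A single constant [C] governs all the
    bounds, so that uniformity in [v], in [tau] and in parameters hidden in [f]
    can be expressed by quantifying [C] first. *)
Fixpoint symbol (N : nat) (C beta tau v : R) (f : R -> R) : Prop :=
  (forall y, v <= y -> `|f y| <= C * (y `^ beta * expR (- (tau * Num.sqrt y))))
  /\ match N with
     | 0 => True
     | N'.+1 => exists2 g : R -> R,
         (forall y : R, 0 < y -> is_derive y 1 f (g y)) &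
         symbol N' C (beta - 1) tau v g
     end.

Lemma symbol_bound N C beta tau v f : symbol N C beta tau v f ->
  forall y, v <= y -> `|f y| <= C * (y `^ beta * expR (- (tau * Num.sqrt y))).
Proof. by case: N => [|N] []. Qed.

Lemma symbolW N C C' beta tau v f : C <= C' ->
  symbol N C beta tau v f -> symbol N C' beta tau v f.
Proof.
move=> CC; elim: N beta f => [|N IH] beta f /= [fC Hg]; split.
- by move=> y /fC /le_trans; apply; rewrite ler_wpM2r ?mulr_ge0 ?powR_ge0 ?expR_ge0.
- by [].
- by move=> y /fC /le_trans; apply; rewrite ler_wpM2r ?mulr_ge0 ?powR_ge0 ?expR_ge0.
- by case: Hg => g dg Sg; exists g => //; exact: IH.
Qed.

Lemma symbolD N C1 C2 beta tau v f1 f2 :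
  symbol N C1 beta tau v f1 -> symbol N C2 beta tau v f2 ->
  symbol N (C1 + C2) beta tau v (fun y => f1 y + f2 y).
Proof.
have H C C' be (f g : R -> R) :
    (forall y, v <= y -> `|f y| <= C * (y `^ be * expR (- (tau * Num.sqrt y)))) ->
    (forall y, v <= y -> `|g y| <= C' * (y `^ be * expR (- (tau * Num.sqrt y)))) ->
    (forall y, v <= y -> `|f y + g y| <= (C + C') * (y `^ be * expR (- (tau * Num.sqrt y)))).
  move=> fC gC y vy; rewrite mulrDl (le_trans (ler_normD _ _))// lerD//.
    exact: fC.
  exact: gC.
elim: N beta f1 f2 => [|N IH] beta f1 f2 /= [fC Hf] [gC Hg]; split => //; try exact: H.
case: Hf => g1 dg1 S1; case: Hg => g2 dg2 S2.
exists (fun y => g1 y + g2 y); last exact: IH.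
by move=> y y0; have h1 := dg1 _ y0; have h2 := dg2 _ y0; exact: is_deriveD.
Qed.

Lemma symbolZ N k C beta tau v f : symbol N C beta tau v f ->
  symbol N (`|k| * C) beta tau v (fun y => k * f y).
Proof.
have H be (f0 : R -> R) :
    (forall y, v <= y -> `|f0 y| <= C * (y `^ be * expR (- (tau * Num.sqrt y)))) ->
    (forall y, v <= y -> `|k * f0 y| <= `|k| * C * (y `^ be * expR (- (tau * Num.sqrt y)))).
  by move=> fC y vy; rewrite normrM -mulrA ler_wpM2l// fC.
elim: N beta f => [|N IH] beta f /= [fC Hf]; split => //; try exact: H.
case: Hf => g dg S; exists (fun y => k * g y); last exact: IH.
by move=> y y0; have h := dg _ y0; exact: is_deriveZ.
Qed.

(** A factor [v `^ p] may be traded for [y `^ p], because [v <= y]. *)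
Lemma symbol_powR N p C beta tau v f : 0 < v -> 0 <= p -> 0 <= C ->
  symbol N C beta tau v f ->
  symbol N C (beta + p) tau v (fun y => v `^ p * f y).
Proof.
move=> v0 p0 C0.
have H be (f0 : R -> R) :
    (forall y, v <= y -> `|f0 y| <= C * (y `^ be * expR (- (tau * Num.sqrt y)))) ->
    (forall y, v <= y -> `|v `^ p * f0 y| <= C * (y `^ (be + p) * expR (- (tau * Num.sqrt y)))).
  move=> fC y vy; have y0 : 0 < y by exact: lt_le_trans vy.
  rewrite normrM ger0_norm ?powR_ge0//.
  rewrite powRDp//.
  rewrite (_ : C * _ = y `^ p * (C * (y `^ be * expR (- (tau * Num.sqrt y))))); last by ring.
  rewrite ler_pM ?powR_ge0 ?fC//.
  by apply: ge0_ler_powR; rewrite // nnegrE ltW.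
elim: N beta f => [|N IH] beta f /= [fC Hf]; split => //; try exact: H.
case: Hf => g dg S; exists (fun y => v `^ p * g y).
  by move=> y y0; have h := dg _ y0; exact: is_deriveZ.
by rewrite addrAC; exact: IH.
Qed.

Lemma sqrt_powR_half (y : R) : 0 <= y -> Num.sqrt y = y `^ 2^-1.
Proof. by move=> y0; rewrite powR12_sqrt. Qed.

(** [| X e^{i th} - b sqrt y | ^+ 2] with [kap = b * cos th]; in the application [X]
    is [v `^ s] and [th] is [pi * s], up to the sign of [b]. *)
Definition denom (b kap X y : R) : R :=
  b ^+ 2 * y - 2 * kap * X * Num.sqrt y + X ^+ 2.

(** Lower bound for the quadratic form with matrix entries [b ^+ 2], [- kap], [1],
    positive as long as [|kap| < b]. *)
Definition denom_gap (b kap : R) : R := (1 - `|kap| / b) * Num.min (b ^+ 2) 1.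

Lemma denom_gap_gt0 b kap : `|kap| < b -> 0 < denom_gap b kap.
Proof.
move=> kb; have b0 : 0 < b by exact: le_lt_trans kb.
rewrite mulr_gt0 ?subr_gt0 ?ltr_pdivrMr ?mul1r//.
by rewrite lt_min exprn_gt0 //= ltr01.
Qed.

(** [kap X sqrt y] is at most [|kap| / b] times [b X sqrt y], and
    [2 b X sqrt y <= b ^+ 2 y + X ^+ 2]. *)
Lemma denom_lb b kap X y : `|kap| < b -> 0 <= X -> 0 <= y ->
  denom_gap b kap * (y + X ^+ 2) <= denom b kap X y.
Proof.
move=> kb X0 y0; have b0 : 0 < b by exact: le_lt_trans kb.
set th := `|kap| / b.
have th1 : th <= 1 by rewrite ler_pdivrMr// mul1r ltW.
have th0 : 0 <= th by rewrite divr_ge0// ltW.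
have q0 := sqrtr_ge0 y.
set q := Num.sqrt y in q0 *.
have yE : y = q ^+ 2 by rewrite sqr_sqrtr.
have hk : kap * X * q <= th * b * (X * q).
  by rewrite /th divfK ?gt_eqF// -mulrA ler_wpM2r ?mulr_ge0 ?ler_norm.
have hm : 2 * (b * q) * X <= (b * q) ^+ 2 + X ^+ 2.
  have := sqr_ge0 (b * q - X); nra.
apply: (@le_trans _ _ ((1 - th) * (b ^+ 2 * y + X ^+ 2))).
  rewrite /denom_gap -mulrA ler_wpM2l ?subr_ge0// mulrDr lerD//.
    by rewrite ler_wpM2r// ge_min lexx.
  by rewrite -[leRHS]mul1r ler_wpM2r ?sqr_ge0// ge_min lexx orbT.
rewrite /denom -/q yE.
have h2 : 0 <= th * ((b * q) ^+ 2 + X ^+ 2 - 2 * (b * q) * X).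
  by rewrite mulr_ge0// subr_ge0.
nra.
Qed.

Lemma denom_gt0 b kap X y : `|kap| < b -> 0 <= X -> 0 < y -> 0 < denom b kap X y.
Proof.
move=> kb X0 y0; apply: lt_le_trans (denom_lb kb X0 (ltW y0)).
by rewrite mulr_gt0 ?denom_gap_gt0// ltr_pwDl// sqr_ge0.
Qed.

(** Up to powers of [v], every function of [y] met below lies in the span of
    these, which is stable under differentiation in [y] with [t] and [X] as
    parameters. *)
Definition std_symbol (b kap t X : R) (j i k : nat) (a y : R) : R :=
  t ^+ j * X ^+ i * (y `^ a * (denom b kap X y) `^ (- k%:R) * expR (- (t * Num.sqrt y))).

Lemma is_derive_std_symbol b kap t X j i k a (y : R) : `|kap| < b -> 0 <= X -> 0 < y ->
  is_derive y 1 (std_symbol b kap t X j i k a)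
    ((a * std_symbol b kap t X j i k (a - 1) y +
      - 2^-1 * std_symbol b kap t X j.+1 i k (a - 2^-1) y) +
     (- (k%:R * b ^+ 2) * std_symbol b kap t X j i k.+1 a y +
      (k%:R * kap) * std_symbol b kap t X j i.+1 k.+1 (a - 2^-1) y)).
Proof.
move=> kb X0 y0.
have D0 := denom_gt0 kb X0 y0.
have s0 : 0 < Num.sqrt y by rewrite sqrtr_gt0.
have hs := is_derive1_sqrt y0.
have ha := is_derive1_powR a y0.
have hD : is_derive y 1 (denom b kap X) (b ^+ 2 - kap * X / Num.sqrt y).
  rewrite /denom; apply: is_derive_eq; rewrite /GRing.scale /=.
  by field; rewrite gt_eqF.
have hDk := @is_derive1_comp R (fun z : R => z `^ (- k%:R)) (denom b kap X) y _ _
  (is_derive1_powR (- k%:R) D0) hD.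
have h0 : is_derive y 1 (fun z : R => - (t * Num.sqrt z)) (- (t * (2 * Num.sqrt y)^-1)).
  by apply: is_derive_eq; rewrite /GRing.scale /=; ring.
have he := @is_derive1_comp R (@expR R) (fun z : R => - (t * Num.sqrt z)) y _ _
  (is_derive_expR _) h0.
rewrite /std_symbol.
apply: is_derive_eq; rewrite /GRing.scale /=.
have -> : - k.+1%:R = - k%:R - 1 :> R by rewrite -natr1 opprD.
have -> : y `^ (a - 2^-1) = y `^ a / Num.sqrt y.
  by rewrite powRDp// powRN sqrt_powR_half// ltW.
rewrite !exprS.
by field; rewrite gt_eqF.
Qed.

(** Powers of [t] created by differentiating the exponential are paid for with
    half of the exponential decay: this keeps the estimates uniform as [t]
    tends to 0. *)
Lemma exp_absorb (j : nat) : exists2 C : R, 0 < C & forall t y, 0 < t -> 0 < y ->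
  t ^+ j * expR (- (t * Num.sqrt y)) <=
  C * (y `^ (- (j%:R / 2)) * expR (- (t / 2 * Num.sqrt y))).
Proof.
have h2 : 0 < 2^-1 :> R by rewrite invr_gt0.
have [C C0 CN] := exp_dominates j h2.
exists C => // t y t0 y0.
have s0 : 0 < Num.sqrt y by rewrite sqrtr_gt0.
have -> : y `^ (- (j%:R / 2)) = Num.sqrt y ^- j.
  rewrite powRN mulrC powRrM -sqrt_powR_half ?(ltW y0)//.
  by rewrite powR_mulrn// ltW.
have -> : expR (- (t * Num.sqrt y)) =
    expR (- (2^-1 * (t * Num.sqrt y))) * expR (- (t / 2 * Num.sqrt y)).
  by rewrite -expRD; congr expR; field.
rewrite !mulrA ler_wpM2r ?expR_ge0// ler_pdivlMr ?exprn_gt0//.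
have z0 : 0 <= t * Num.sqrt y by rewrite mulr_ge0 ?ltW.
have := CN _ z0; rewrite mulrA; apply: le_trans.
rewrite mulrAC -exprMn.
by rewrite ler_wpM2r ?expR_ge0// lerXn2r ?nnegrE ?addr_ge0// lerDr.
Qed.

(** Powers of [X] in the numerator count as powers of [sqrt y], because the
    denominator controls [X ^+ 2] as well as [y]. *)
Lemma denom_ratio b kap X y i k : `|kap| < b -> (i <= 2 * k)%N ->
  0 <= X -> 0 < y ->
  X ^+ i * denom b kap X y `^ (- k%:R) <=
  denom_gap b kap `^ (- k%:R) * y `^ (i%:R / 2 - k%:R).
Proof.
move=> kb ik X0 y0.
have D0 := denom_gt0 kb X0 y0.
have dl := denom_gap_gt0 kb.
have Y0 : 0 < y + X ^+ 2 by rewrite ltr_pwDl// sqr_ge0.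
have XY : X ^+ i <= (y + X ^+ 2) `^ (i%:R / 2).
  rewrite mulrC powRrM -sqrt_powR_half ?(ltW Y0)// powR_mulrn ?sqrtr_ge0//.
  rewrite lerXn2r ?nnegrE ?sqrtr_ge0//.
  by rewrite -[leLHS](ger0_norm X0) -sqrtr_sqr ler_sqrt ?(ltW Y0)// lerDr ltW.
have dY : 0 < denom_gap b kap * (y + X ^+ 2) := mulr_gt0 dl Y0.
apply: (@le_trans _ _ ((y + X ^+ 2) `^ (i%:R / 2) *
    (denom_gap b kap * (y + X ^+ 2)) `^ (- k%:R))).
  rewrite ler_pM ?exprn_ge0 ?powR_ge0// !powRN lef_pV2 ?posrE ?powR_gt0//.
  by apply: ge0_ler_powR; rewrite ?nnegrE ?(ltW D0) ?(ltW dY)//; apply: denom_lb => //; exact: ltW.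
rewrite powRM ?(ltW dl) ?(ltW Y0)// mulrCA ler_wpM2l ?powR_ge0// -powRDp//.
have e0 : 0 <= k%:R - i%:R / 2 :> R.
  by rewrite subr_ge0 ler_pdivrMr// -natrM mulnC ler_nat.
rewrite -opprB !powRN lef_pV2 ?posrE ?powR_gt0//.
by apply: ge0_ler_powR; rewrite ?nnegrE ?(ltW y0) ?(ltW Y0) ?lerDl ?sqr_ge0.
Qed.

Lemma std_symbol_bound b kap j i k a : `|kap| < b -> (i <= 2 * k)%N ->
  exists2 C : R, 0 <= C & forall t X y, 0 < t -> 0 <= X -> 0 < y ->
    `|std_symbol b kap t X j i k a y| <=
    C * (y `^ (a + i%:R / 2 - k%:R - j%:R / 2) * expR (- (t / 2 * Num.sqrt y))).
Proof.
move=> kb ik; have [C C0 CN] := exp_absorb j.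
exists (C * denom_gap b kap `^ (- k%:R)); first by rewrite mulr_ge0 ?powR_ge0 ?ltW.
move=> t X y t0 X0 y0.
rewrite /std_symbol ger0_norm; last first.
  by rewrite !mulr_ge0 ?exprn_ge0 ?powR_ge0 ?expR_ge0 ?(ltW t0).
have -> : t ^+ j * X ^+ i * (y `^ a * denom b kap X y `^ (- k%:R) *
      expR (- (t * Num.sqrt y))) =
    y `^ a * ((t ^+ j * expR (- (t * Num.sqrt y))) *
    (X ^+ i * denom b kap X y `^ (- k%:R))) by ring.
apply: le_trans (ler_wpM2l (powR_ge0 _ _) (ler_pM _ _ (CN _ _ t0 y0) (denom_ratio kb ik X0 y0))) _.
- by rewrite mulr_ge0 ?exprn_ge0 ?expR_ge0 ?ltW.
- by rewrite mulr_ge0 ?exprn_ge0 ?powR_ge0.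
rewrite (_ : a + _ - _ - _ = a + (- (j%:R / 2)) + (i%:R / 2 - k%:R)); last by ring.
by rewrite !powRDp// le_eqVlt; apply/orP; left; apply/eqP; ring.
Qed.

(** The order counts [X] and [1 / t] as [sqrt y] and the denominator as [y]; every
    one of the four terms of [is_derive_std_symbol] then has order one less. *)
Lemma symbol_std_symbol b kap N j i k a : `|kap| < b -> (i <= 2 * k)%N ->
  exists2 C : R, 0 <= C & forall t X v, 0 < t -> 0 <= X -> 0 < v ->
    symbol N C (a + i%:R / 2 - k%:R - j%:R / 2) (t / 2) v (std_symbol b kap t X j i k a).
Proof.
move=> kb; elim: N j i k a => [|N IH] j i k a ik;
  have [C C0 CN] := @std_symbol_bound b kap j i k a kb ik.
  exists C => // t X v t0 X0 v0; split=> // y vy.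
  by apply: CN => //; exact: lt_le_trans vy.
have ik1 : (i <= 2 * k.+1)%N by rewrite (leq_trans ik)// leq_mul2l leqnSn orbT.
have ik2 : (i.+1 <= 2 * k.+1)%N by rewrite mulnS add2n ltnS (leq_trans ik)// leqnSn.
have [C1 C10 S1] := IH j i k (a - 1) ik.
have [C2 C20 S2] := IH j.+1 i k (a - 2^-1) ik.
have [C3 C30 S3] := IH j i k.+1 a ik1.
have [C4 C40 S4] := IH j i.+1 k.+1 (a - 2^-1) ik2.
pose K := (`|a| * C1 + `|- 2^-1| * C2) + (`|- (k%:R * b ^+ 2)| * C3 + `|k%:R * kap| * C4).
have K0 : 0 <= K by rewrite !addr_ge0 ?mulr_ge0.
exists (C + K); first by rewrite addr_ge0.
move=> t X v t0 X0 v0; split.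
  move=> y vy; have y0 : 0 < y by exact: lt_le_trans vy.
  apply: le_trans (CN _ _ _ t0 X0 y0) _.
  by rewrite ler_wpM2r ?mulr_ge0 ?powR_ge0 ?expR_ge0// lerDl.
eexists; first by move=> y y0; exact: is_derive_std_symbol.
apply: (@symbolW _ K); first by rewrite lerDr.
apply: symbolD; apply: symbolD; apply: symbolZ.
- by have := S1 _ _ _ t0 X0 v0; congr symbol; ring.
- by have := S2 _ _ _ t0 X0 v0; congr symbol; rewrite -natr1; field.
- by have := S3 _ _ _ t0 X0 v0; congr symbol; rewrite -natr1; field.
- by have := S4 _ _ _ t0 X0 v0; congr symbol; rewrite -!natr1; field.
Qed.

End symbols.

(** * Radial integration by parts *)

Section radial_part.
Context {R : realType}.
Notation mu := (@lebesgue_measure R).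

(** Up to a constant, a Bessel function of order [(d - 1) / 2] in [rho * r] times a
    power of [r]: the oscillating weight in the radial variable. *)
Definition radial (d : nat) (rho r : R) : R := r ^+ d * bessel_entire d (rho ^+ 2 * r ^+ 2).

Lemma continuous_radial d rho : continuous (radial d rho).
Proof.
move=> r; apply: cvgM; first exact: exprn_continuous.
apply: continuous_cvg; first exact: continuous_bessel_entire.
by apply: cvgMr; exact: exprn_continuous.
Qed.

Lemma radial_le d rho r : 0 <= r -> `|radial d rho r| <= r ^+ d.
Proof.
move=> r0; rewrite normrM normrX ger0_norm// -[leRHS]mulr1 ler_wpM2l ?exprn_ge0//.
by rewrite bessel_entire_le1// mulr_ge0 ?sqr_ge0.
Qed.

(** The identity behind the integration by parts; it is the classical formula
    for the derivative of [z ^ nu J_nu z]. *)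
Lemma is_derive_radial_primitive d rho (r : R) :
  is_derive r 1 (fun z => z ^+ d.+1 * bessel_entire d.+2 (rho ^+ 2 * z ^+ 2))
    (d.+1%:R * radial d rho r).
Proof.
have h1 : is_derive r 1 (fun z : R => rho ^+ 2 * z ^+ 2) (rho ^+ 2 * (2 * r)).
  by apply: is_derive_eq; rewrite /GRing.scale /= ; ring.
have h2 : is_derive r 1 (fun z : R => bessel_entire d.+2 (rho ^+ 2 * z ^+ 2))
    (- (2 * d.+3%:R)^-1 * bessel_entire d.+4 (rho ^+ 2 * r ^+ 2) * (rho ^+ 2 * (2 * r))).
  exact: (@is_derive1_comp R (bessel_entire d.+2) (fun z : R => rho ^+ 2 * z ^+ 2) r _ _
    (is_derive_bessel_entire d.+2 _) h1).
have hX : is_derive r 1 (fun z : R => z ^+ d.+1) (d.+1%:R * r ^+ d).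
  have := @is_deriveX _ _ (fun z : R => z) d.+1 r 1 1 (is_derive_id r 1).
  rewrite (_ : _ ^+ d.+1 = (fun z : R => z ^+ d.+1)); last first.
    by apply/funext => z; rewrite exprfctE.
  by rewrite /GRing.scale /= mulr1.
have h3 := is_deriveM hX h2.
apply: (is_derive_eq h3); rewrite /GRing.scale /= /radial (bessel_entire_rec d) exprS.
by field; rewrite ?andbT; do ?[apply/andP; split]; rewrite gt_eqF// ltr_pwDl.
Qed.

(** Away from 0 the exponential also absorbs negative powers of [y], at the
    price of a constant that depends on [v] and [tau].  It serves to justify the
    integrations by parts and does not enter the final bounds. *)
Lemma powR_exp_tail (be tau v : R) (N : nat) : 0 < tau -> 0 < v ->
  exists2 C : R, 0 < C & forall y, v <= y ->
    y `^ be * expR (- (tau * Num.sqrt y)) <= C * (1 + Num.sqrt y) ^- N.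
Proof.
move=> tau0 v0.
have [M beM] : exists M : nat, 2 * be <= M%:R.
  by eexists; rewrite ltW//; exact: le_lt_trans (ler_norm _) (archi_boundP (normr_ge0 _)).
have [C C0 CN] := exp_dominates (M + N) tau0.
exists ((v `^ be + 1) * C); first by rewrite mulr_gt0// ltr_pwDl// powR_gt0.
move=> y vy; have y0 : 0 < y by exact: lt_le_trans vy.
have s0 : 0 <= Num.sqrt y by exact: sqrtr_ge0.
have s1 : 0 < 1 + Num.sqrt y by rewrite ltr_pwDl.
have hb : y `^ be <= (v `^ be + 1) * (1 + Num.sqrt y) ^+ M.
  have [be0|be0] := leP be 0.
    rewrite -[leLHS]mulr1 ler_pM ?powR_ge0 ?exprn_ege1 ?lerDl//.
    rewrite -[leLHS]addr0 lerD// -[be]opprK [y `^ _]powRN [v `^ _]powRN lef_pV2 ?posrE ?powR_gt0//.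
    by apply: ge0_ler_powR; rewrite ?nnegrE ?oppr_ge0 ?(ltW v0) ?(ltW y0).
  rewrite -[leLHS]mul1r ler_pM ?powR_ge0 ?lerDr ?powR_ge0//.
  have -> : y `^ be = Num.sqrt y `^ (2 * be).
    by rewrite sqrt_powR_half ?(ltW y0)// -powRrM mulrA mulVf ?mul1r.
  apply: (@le_trans _ _ ((1 + Num.sqrt y) `^ (2 * be))).
    by apply: ge0_ler_powR; rewrite ?nnegrE ?mulr_ge0 ?(ltW be0) ?(ltW s1)// lerDr.
  by apply: ge1_powR_le_exprn; rewrite // lerDl.
rewrite ler_pdivlMr ?exprn_gt0//.
apply: (@le_trans _ _ ((v `^ be + 1) * (1 + Num.sqrt y) ^+ M *
   expR (- (tau * Num.sqrt y)) * (1 + Num.sqrt y) ^+ N)).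
  by rewrite ler_wpM2r ?exprn_ge0 ?(ltW s1)// ler_wpM2r ?expR_ge0.
have := CN _ s0; rewrite exprD => h.
rewrite (_ : _ * _ * _ * _ = (v `^ be + 1) * ((1 + Num.sqrt y) ^+ M *
  (1 + Num.sqrt y) ^+ N * expR (- (tau * Num.sqrt y)))); last by ring.
by rewrite ler_wpM2l// addr_ge0 ?powR_ge0.
Qed.

Lemma le_sqrt_shift (v r : R) : 0 <= v -> 0 <= r -> r <= Num.sqrt (v + r ^+ 2).
Proof.
move=> v0 r0; rewrite -[leLHS](ger0_norm r0) -sqrtr_sqr ler_sqrt ?lerDr//.
by rewrite addr_ge0 ?sqr_ge0.
Qed.

Lemma shift_bound (h : R -> R) (C be tau v : R) (N : nat) : 0 < tau -> 0 < v ->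
  (forall y, v <= y -> `|h y| <= C * (y `^ be * expR (- (tau * Num.sqrt y)))) ->
  exists2 C' : R, 0 <= C' & forall r, 0 <= r ->
    `|h (v + r ^+ 2)| <= C' * (1 + r) ^- N.
Proof.
move=> tau0 v0 hC.
have [C1 C10 h1] := powR_exp_tail be N tau0 v0.
exists (`|C| * C1); first by rewrite mulr_ge0 ?(ltW C10).
move=> r r0; have vy : v <= v + r ^+ 2 by rewrite lerDl sqr_ge0.
apply: le_trans (hC _ vy) _.
apply: (@le_trans _ _ (`|C| * (C1 * (1 + Num.sqrt (v + r ^+ 2)) ^- N))).
  apply: le_trans (ler_wpM2r _ (ler_norm C)) _.
    by rewrite mulr_ge0 ?powR_ge0 ?expR_ge0.
  by rewrite ler_wpM2l// h1.
rewrite mulrA ler_wpM2l ?mulr_ge0 ?(ltW C10)//.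
rewrite lef_pV2 ?posrE; [|by rewrite exprn_gt0// ltr_pwDl// sqrtr_ge0|by rewrite exprn_gt0// ltr_pwDl].
by rewrite lerXn2r ?nnegrE ?addr_ge0 ?sqrtr_ge0// lerD2l le_sqrt_shift// ltW.
Qed.

Lemma continuous_shift (h : R -> R) (v : R) : 0 < v ->
  (forall y : R, 0 < y -> {for y, continuous h}) ->
  continuous (fun r : R => h (v + r ^+ 2)).
Proof.
move=> v0 ch r; apply: (cvg_comp (fun r : R => v + r ^+ 2) h); last first.
  by apply: ch; rewrite ltr_pwDl// sqr_ge0.
by apply: cvgD; [exact: cvg_cst|exact: exprn_continuous].
Qed.

Lemma integrable_radial d rho (h : R -> R) (C be tau v : R) : 0 < tau -> 0 < v ->
  (forall y : R, 0 < y -> {for y, continuous h}) ->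
  (forall y, v <= y -> `|h y| <= C * (y `^ be * expR (- (tau * Num.sqrt y)))) ->
  mu.-integrable `]0, +oo[ (EFin \o (fun r => radial d rho r * h (v + r ^+ 2))).
Proof.
move=> tau0 v0 ch hC.
have [C' C'0 h'] := shift_bound d.+2 tau0 v0 hC.
apply: (@integrable_halfline _ _ C' d%:R 1) => //.
- by rewrite (@lt_le_trans _ _ 0)// ltrN10.
- apply: continuous_measurable_halfline => r r0; apply: cvgM.
    exact: continuous_radial.
  exact: continuous_shift.
move=> r r0.
apply: (@le_trans _ _ (C' * (r `^ d%:R * (1 + 1 * r) ^- d.+2))); last first.
  by rewrite ler_wpM2l// pow_kernel_lb// -natrD addn2.
rewrite powR_mulrn ?(ltW r0)// mul1r mulrCA normrM ler_pM//.
  by apply: radial_le; exact: ltW.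
by apply: h'; exact: ltW.
Qed.

(** The boundary terms vanish: at 0 because of the factor [r ^+ d.+1], at infinity
    because [f (v + r ^+ 2)] decays faster than any power of [r]. *)
Lemma radial_by_parts d rho (f g : R -> R) (C be C' be' tau v : R) :
  0 < tau -> 0 < v ->
  (forall y : R, 0 < y -> is_derive y 1 f (g y)) ->
  (forall y : R, 0 < y -> {for y, continuous g}) ->
  (forall y, v <= y -> `|f y| <= C * (y `^ be * expR (- (tau * Num.sqrt y)))) ->
  (forall y, v <= y -> `|g y| <= C' * (y `^ be' * expR (- (tau * Num.sqrt y)))) ->
  \int[mu]_(r in `]0, +oo[) (radial d rho r * f (v + r ^+ 2)) =
  - (2 / d.+1%:R) * \int[mu]_(r in `]0, +oo[) (radial d.+2 rho r * g (v + r ^+ 2)).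
Proof.
move=> tau0 v0 dfg cg fC gC.
have cf (y : R) : 0 < y -> {for y, continuous f}.
  move=> y0; apply/differentiable_continuous/derivable1_diffP.
  by case: (dfg _ y0).
have i1 := integrable_radial d rho tau0 v0 cf fC.
have i2 := integrable_radial d.+2 rho tau0 v0 cg gC.
pose F (r : R) := r ^+ d.+1 * bessel_entire d.+2 (rho ^+ 2 * r ^+ 2) * f (v + r ^+ 2).
pose G (r : R) := d.+1%:R * (radial d rho r * f (v + r ^+ 2)) +
  2 * (radial d.+2 rho r * g (v + r ^+ 2)).
have dF (r : R) : 0 < r -> is_derive r 1 F (G r).
  move=> r0; have y0 : 0 < v + r ^+ 2 by rewrite ltr_pwDl// sqr_ge0.
  have h1 := is_derive_radial_primitive d rho r.
  have h2 : is_derive r 1 (fun z : R => v + z ^+ 2) (2 * r).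
    by apply: is_derive_eq; rewrite /GRing.scale /=; ring.
  have h3 := @is_derive1_comp R f (fun z : R => v + z ^+ 2) r _ _ (dfg _ y0) h2.
  rewrite /F /G; apply: is_derive_eq; rewrite /GRing.scale /= /radial !exprS; ring.
have iG1 : mu.-integrable `]0, +oo[ (EFin \o (fun r => d.+1%:R * (radial d rho r * f (v + r ^+ 2)))).
  rewrite (_ : _ \o _ = (fun r => d.+1%:R%:E * (radial d rho r * f (v + r ^+ 2))%:E)%E)//.
  exact: integrableZl.
have iG2 : mu.-integrable `]0, +oo[ (EFin \o (fun r => 2 * (radial d.+2 rho r * g (v + r ^+ 2)))).
  rewrite (_ : _ \o _ = (fun r => 2%:E * (radial d.+2 rho r * g (v + r ^+ 2))%:E)%E)//.
  exact: integrableZl.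
have : \int[mu]_(r in `]0, +oo[) G r = 0 - 0.
  apply: (FTC_halfline _ dF).
  - rewrite (_ : _ \o _ = (fun r => (d.+1%:R * (radial d rho r * f (v + r ^+ 2)))%:E +
       (2 * (radial d.+2 rho r * g (v + r ^+ 2)))%:E)%E)//.
    exact: integrableD.
  - move=> r r0; apply: cvgD; apply: cvgMr; apply: cvgM; try exact: continuous_radial.
      exact: continuous_shift.
    exact: continuous_shift.
  - apply: cvg_at_right_filter.
    have : F r @[r --> (0 : R)] --> F 0.
      apply: cvgM; last exact: continuous_shift.
      apply: cvgM; first exact: exprn_continuous.
      apply: continuous_cvg; first exact: continuous_bessel_entire.
      by apply: cvgMr; exact: exprn_continuous.
    by rewrite {2}/F expr0n !mul0r.
  - have [C1 C10 h1] := shift_bound d.+2 tau0 v0 fC.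
    apply: (@cvgy0_le_inv _ _ C1) => r r1.
    have r0 : 0 < r by exact: lt_le_trans r1.
    rewrite /F normrM ler_pdivlMr//.
    apply: (@le_trans _ _ (r ^+ d.+1 * (C1 * (1 + r) ^- d.+2) * r)).
      rewrite ler_wpM2r ?(ltW r0)// ler_pM//; last exact/h1/ltW.
      rewrite normrM normrX (ger0_norm (ltW r0)) -[leRHS]mulr1 ler_wpM2l ?exprn_ge0 ?(ltW r0)//.
      by rewrite bessel_entire_le1// mulr_ge0 ?sqr_ge0.
    rewrite mulrAC -exprSr mulrCA -[leRHS]mulr1 ler_wpM2l//.
    rewrite ler_pdivrMr ?exprn_gt0 ?ltr_pwDl ?(ltW r0)// mul1r.
    by rewrite lerXn2r ?nnegrE ?addr_ge0 ?(ltW r0)// lerDr.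
rewrite subr0 RintegralD// !RintegralZl//.
set I1 := Rintegral _ _ _; set I2 := Rintegral _ _ _ => h.
apply: (@mulfI _ d.+1%:R); first by rewrite pnatr_eq0.
by rewrite -[LHS]subr0 -{}h; field; rewrite addrC natr1 pnatr_eq0.
Qed.

End radial_part.

(** * Iterated integrals over the quadrant *)

Section quadrant.
Context {R : realType}.
Notation mu := (@lebesgue_measure R).
Notation RM := (measurableTypeR R).
Notation pos := (`]0%R, +oo[%classic : set RM).
Notation quad := (`]0%R, +oo[%classic `*` `]0%R, +oo[%classic : set (RM * RM)).
Notation mu2 := (mu \x mu)%E.

Lemma measurable_quad : measurable quad.
Proof. exact: measurableX. Qed.

Lemma in_quad (p : R * R) : quad p <-> 0 < p.1 /\ 0 < p.2.
Proof. by rewrite /setX /= !in_itv/= !andbT. Qed.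

Lemma integral_fine (F : R -> \bar R) :
  mu.-integrable setT F ->
  (\int[mu]_x (fine (F x))%:E = \int[mu]_x F x)%E /\
  mu.-integrable setT (EFin \o (fine \o F)).
Proof.
move=> iF.
have mF := measurable_int _ iF.
have mfF : measurable_fun setT (EFin \o (fine \o F)).
  apply/measurable_EFinP; apply: measurableT_comp => //.
have ae : ae_eq mu setT F (EFin \o (fine \o F)).
  apply: filterS (integrable_ae measurableT iF) => x h Tx.
  by rewrite /= fineK// h.
split.
  by apply/esym; exact: ae_eq_integral.
apply: le_integrable iF => // x _ /=.
by case: (F x) => [r||]//=; rewrite ?normr0 ?leey.
Qed.

Lemma restrict_quad (f : R * R -> R) (x y : R) :
  (((EFin \o f) \_ quad) (x, y) =
   ((fun x => ((fun y => (f (x, y))%:E) \_ pos) y) \_ pos) x)%E.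
Proof.
rewrite !patchE; have [xp|xp] := boolP (x \in pos).
  have [yp|yp] := boolP (y \in pos).
    by rewrite mem_set//; split; exact: set_mem.
  rewrite memNset// => -[_ /= h]; move/negP : yp; apply.
  by rewrite inE.
rewrite memNset// => -[/= h _]; move/negP : xp; apply.
by rewrite inE.
Qed.

(** The inner integrals are finite only almost everywhere; taking [fine] of them
    changes the outer integrand on a null set. *)
Lemma quad_fubini (f : R * R -> R) : mu2.-integrable quad (EFin \o f) ->
  [/\ \int[mu]_(x in pos) \int[mu]_(y in pos) f (x, y) =
        \int[mu2]_(p in quad) f p,
     \int[mu]_(y in pos) \int[mu]_(x in pos) f (x, y) =
        \int[mu2]_(p in quad) f p,
     mu.-integrable pos (EFin \o (fun x => \int[mu]_(y in pos) f (x, y))) &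
     mu.-integrable pos (EFin \o (fun y => \int[mu]_(x in pos) f (x, y)))].
Proof.
move=> iQ; have mp : measurable pos by exact: measurable_itv.
have mq := measurable_quad.
pose g := (EFin \o f) \_ quad.
have ig : mu2.-integrable setT g := (integrable_mkcond _ mq).1 iQ.
have FE : fubini_F mu g = (fun x => \int[mu]_(y in pos) (f (x, y))%:E)%E \_ pos.
  apply/funext => x; rewrite /fubini_F patchE; case: ifPn => xp.
    rewrite [RHS]integral_mkcond; apply: eq_integral => y _.
    by rewrite /g restrict_quad patchE xp.
  by apply: integral0_eq => y _; rewrite /g restrict_quad patchE (negbTE xp).
have GE : fubini_G mu g = (fun y => \int[mu]_(x in pos) (f (x, y))%:E)%E \_ pos.
  apply/funext => y; rewrite /fubini_G patchE; case: ifPn => yp.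
    rewrite [RHS]integral_mkcond; apply: eq_integral => x _.
    by rewrite /g restrict_quad patchE [in RHS]patchE; case: ifP => //; rewrite patchE yp.
  apply: integral0_eq => x _; rewrite /g restrict_quad !patchE (negbTE yp).
  by case: ifP.
have [eF iF] := integral_fine (integrable_fubini_F ig).
have iG0 : mu.-integrable setT (fubini_G mu g).
  have mg := measurable_int _ ig.
  have mag : measurable_fun setT (abse \o g) by exact: measurableT_comp.
  apply/integrableP; split; first exact: (measurable_fubini_G ig).
  have h := (@integrable21ltyP _ _ _ _ _ mu mu _ mg).1 ig.
  apply: le_lt_trans h.
  apply: ge0_le_integral => //.
  - by apply: measurableT_comp => //; exact: (measurable_fubini_G ig).
  - by apply: (measurable_fun_fubini_tonelli_G (abse \o g)) => //= p; exact: abse_ge0.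
  - move=> y _; apply: le_abse_integral => //.
    exact: measurableT_comp.
have [eG iG] := integral_fine iG0.
have fF : EFin \o (fine \o fubini_F mu g) =
    (EFin \o (fun x => \int[mu]_(y in pos) f (x, y))) \_ pos.
  by apply/funext => x; rewrite /= FE !patchE; case: ifPn.
have fG : EFin \o (fine \o fubini_G mu g) =
    (EFin \o (fun y => \int[mu]_(x in pos) f (x, y))) \_ pos.
  by apply/funext => x; rewrite /= GE !patchE; case: ifPn.
have EI : (\int[mu2]_(p in quad) (f p)%:E)%E = (\int[mu2]_p g p)%E.
  by rewrite integral_mkcond.
split.
- rewrite /Rintegral EI; apply: (congr1 fine).
  rewrite -(@integral12_prod_meas1 _ _ _ _ _ mu mu g ig) -eF.
  rewrite integral_mkcond.
  by apply: eq_integral => x _; rewrite -/(EFin \o _) -[in LHS]fF.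
- rewrite /Rintegral EI; apply: (congr1 fine).
  rewrite -(@integral21_prod_meas1 _ _ _ _ _ mu mu g ig) -eG.
  rewrite integral_mkcond.
  by apply: eq_integral => x _; rewrite -[in LHS]fG.
- by apply: (integrable_mkcond _ mp).2; rewrite -fF.
- by apply: (integrable_mkcond _ mp).2; rewrite -fG.
Qed.

Lemma quad_tonelli (f : R * R -> R) :
  measurable_fun quad f -> (forall p, quad p -> 0 <= f p) ->
  [/\ (\int[mu]_(x in pos) \int[mu]_(y in pos) (f (x, y))%:E =
        \int[mu2]_(p in quad) (f p)%:E)%E,
     (\int[mu]_(y in pos) \int[mu]_(x in pos) (f (x, y))%:E =
        \int[mu2]_(p in quad) (f p)%:E)%E &
     measurable_fun pos (fun y => \int[mu]_(x in pos) (f (x, y))%:E)%E].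
Proof.
move=> mf f0.
have mp : measurable pos by exact: measurable_itv.
have mq := measurable_quad.
pose g := (EFin \o f) \_ quad.
have mg : measurable_fun setT g.
  by apply/(measurable_restrictT _ _).1 => //; exact/measurable_EFinP.
have g0 p : (0 <= g p)%E by apply: erestrict_ge0 => q qq; rewrite lee_fin f0.
have FE : (fun x => \int[mu]_y g (x, y))%E =
    (fun x => \int[mu]_(y in pos) (f (x, y))%:E)%E \_ pos.
  apply/funext => x; rewrite patchE; case: ifPn => xp.
    rewrite [RHS]integral_mkcond; apply: eq_integral => y _.
    by rewrite /g restrict_quad patchE xp.
  by apply: integral0_eq => y _; rewrite /g restrict_quad patchE (negbTE xp).
have GE : (fun y => \int[mu]_x g (x, y))%E =
    (fun y => \int[mu]_(x in pos) (f (x, y))%:E)%E \_ pos.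
  apply/funext => y; rewrite patchE; case: ifPn => yp.
    rewrite [RHS]integral_mkcond; apply: eq_integral => x _.
    by rewrite /g restrict_quad patchE [in RHS]patchE; case: ifP => //; rewrite patchE yp.
  apply: integral0_eq => x _; rewrite /g restrict_quad !patchE (negbTE yp).
  by case: ifP.
have EI : (\int[mu2]_(p in quad) (f p)%:E)%E = (\int[mu2]_p g p)%E.
  by rewrite integral_mkcond.
split.
- by rewrite EI (fubini_tonelli1 g mg g0) /fubini_F FE -integral_mkcond.
- by rewrite EI (fubini_tonelli2 g mg g0) /fubini_G GE -integral_mkcond.
- apply/(measurable_restrictT _ _) => //; rewrite -GE.
  exact: (measurable_fun_fubini_tonelli_G g).
Qed.

(** The kernel that dominates the double integrals below.  The power of [p.1]
    in front of the second factor is the one that makes its integral in the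
    second variable a constant, leaving a multiple of [pow_kernel]. *)
Definition quad_kernel (e c rho : R) (p : R * R) : R :=
  pow_kernel e rho p.1 * (p.1 `^ (2 * (c - 1)) * (p.2 + p.1 ^+ 2) `^ (- c)).

Lemma quad_kernel_ge0 e c rho p : 0 <= quad_kernel e c rho p.
Proof. by rewrite mulr_ge0 ?pow_kernel_ge0// mulr_ge0 ?powR_ge0. Qed.

Lemma measurable_powRc (f : RM * RM -> R) (a : R) :
  measurable_fun setT f -> measurable_fun setT (fun p => f p `^ a).
Proof. by move=> mf; apply: (measurableT_comp (measurable_powR a)). Qed.

Lemma measurable_shift :
  measurable_fun setT (fun p : RM * RM => p.2 + p.1 ^+ 2 : R).
Proof.
apply: measurable_funD; first exact: measurable_snd.
by apply: measurable_funX; exact: measurable_fst.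
Qed.

Lemma measurable_quad_kernel e c rho : 0 < rho -> measurable_fun quad (quad_kernel e c rho).
Proof.
move=> rho0.
pose K' (p : RM * RM) : R := (p.1 `^ e * (1 + rho * p.1) `^ (- (e + 2))) *
  (p.1 `^ (2 * (c - 1)) * (p.2 + p.1 ^+ 2) `^ (- c)).
apply: (@eq_measurable_fun _ _ _ _ _ K').
  by move=> p; rewrite inE => /in_quad[p1 _]; rewrite /quad_kernel pow_kernelE.
apply: measurable_funTS.
have m1 : measurable_fun setT (fun p : RM * RM => p.1 : R) by exact: measurable_fst.
apply: measurable_funM; apply: measurable_funM; apply: measurable_powRc => //.
  by apply: measurable_funD => //; apply: measurable_funM.
exact: measurable_shift.
Qed.

Lemma integral_quad_kernel e c rho : 0 < rho -> -1 < e -> 1 < c ->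
  (\int[mu]_(r in pos) \int[mu]_(v in pos) (quad_kernel e c rho (r, v))%:E =
   (rho `^ (- (e + 1)) / ((e + 1) * (c - 1)))%:E)%E.
Proof.
move=> rho0 e1 c1.
have e10 : 0 < e + 1 by rewrite -ltrBlDr sub0r.
have c10 : 0 < c - 1 by rewrite subr_gt0.
have inner (r : R) : 0 < r ->
    (\int[mu]_(v in pos) (quad_kernel e c rho (r, v))%:E = ((c - 1)^-1 * pow_kernel e rho r)%:E)%E.
  move=> r0; have r20 : 0 < r ^+ 2 by rewrite exprn_gt0.
  rewrite /quad_kernel /=.
  under eq_integral do rewrite mulrA EFinM.
  rewrite ge0_integralZl_EFin//.
  - rewrite integral_powR_shift// -EFinM; congr EFin.
    have -> : (r ^+ 2) `^ (1 - c) = (r `^ (2 * (c - 1)))^-1.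
      by rewrite -powR_mulrn ?(ltW r0)// -powRrM -powRN; congr (_ `^ _); ring.
    by field; rewrite !gt_eqF ?powR_gt0.
  - by move=> v _; rewrite lee_fin powR_ge0.
  - apply/measurable_EFinP; apply: measurable_funTS.
    apply: (measurableT_comp (measurable_powR _)).
    exact: measurable_funD.
  - by rewrite mulr_ge0 ?powR_ge0 ?pow_kernel_ge0.
rewrite (eq_integral (fun r : RM => (c - 1)^-1%:E * (pow_kernel e rho r)%:E)%E); last first.
  by move=> r; rewrite inE/= in_itv/= andbT => r0; rewrite inner// EFinM.
rewrite ge0_integralZl_EFin//.
- rewrite integral_pow_kernel// -EFinM; congr EFin.
  by field; rewrite !gt_eqF.
- by move=> r _; rewrite lee_fin pow_kernel_ge0.
- apply/measurable_EFinP.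
  by apply: continuous_measurable_halfline => x x0; exact: continuous_pow_kernel.
- by rewrite invr_ge0 ltW.
Qed.

Lemma integrable_quad_dom (f : R * R -> R) (C e c rho : R) :
  0 < rho -> -1 < e -> 1 < c -> measurable_fun quad f ->
  (forall p, quad p -> `|f p| <= C * quad_kernel e c rho p) ->
  mu2.-integrable quad (EFin \o f).
Proof.
move=> rho0 e1 c1 mf fC.
have mq := measurable_quad.
apply: (@le_integrable _ _ _ mu2 _ _ (EFin \o f) (fun p => C%:E * (quad_kernel e c rho p)%:E)%E) => //.
- exact/measurable_EFinP.
- by move=> p qp; rewrite lee_fin (le_trans (fC _ qp))// ler_norm.
- apply: integrableZl => //; apply/integrableP; split.
    by apply/measurable_EFinP; exact: measurable_quad_kernel.
  under eq_integral do rewrite /= ger0_norm ?quad_kernel_ge0//.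
  have [<- _ _] := quad_tonelli (measurable_quad_kernel e c rho0) (fun p _ => quad_kernel_ge0 e c rho p).
  by rewrite integral_quad_kernel// ltry.
Qed.

End quadrant.

(** * Uniform bound for oscillating double integrals *)

Section master.
Context {R : realType}.
Notation mu := (@lebesgue_measure R).
Notation RM := (measurableTypeR R).
Notation pos := (`]0%R, +oo[%classic : set RM).
Notation quad := (`]0%R, +oo[%classic `*` `]0%R, +oo[%classic : set (RM * RM)).
Notation mu2 := (mu \x mu)%E.

Lemma symbol_continuous N C be tau v (f : R -> R) : symbol N.+1 C be tau v f ->
  forall y : R, 0 < y -> {for y, continuous f}.
Proof.
move=> [_ [g dg _]] y y0; apply/differentiable_continuous/derivable1_diffP.
by case: (dg _ y0).
Qed.

Lemma symbol_deriv N C be tau v (f : R -> R) : symbol N.+1 C be tau v f ->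
  exists2 g : R -> R, (forall y : R, 0 < y -> is_derive y 1 f (g y)) &
    symbol N C (be - 1) tau v g.
Proof. by case. Qed.

(** [N] integrations by parts; the last derivative [h] is only known through its
    symbol bound of order [be - N]. *)
Lemma radial_by_parts_iter N d C be tau v rho (f : R -> R) : 0 < tau -> 0 < v ->
  symbol N.+1 C be tau v f ->
  exists h : R -> R, [/\ forall y : R, 0 < y -> {for y, continuous h},
    forall y, v <= y -> `|h y| <= C * (y `^ (be - N%:R) * expR (- (tau * Num.sqrt y))) &
    `|\int[mu]_(r in `]0, +oo[) (radial d rho r * f (v + r ^+ 2))| <= 2 ^+ N *
    `|\int[mu]_(r in `]0, +oo[) (radial (d + 2 * N) rho r * h (v + r ^+ 2))| ].
Proof.
move=> tau0 v0; elim: N d be f => [|N IH] d be f Sf.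
  exists f; split; first exact: symbol_continuous Sf.
    by rewrite subr0; exact: symbol_bound Sf.
  by rewrite expr0 mul1r muln0 addn0.
have fC := symbol_bound Sf; have [g dg Sg] := symbol_deriv Sf.
have [h [ch hC hI]] := IH d.+2 (be - 1) g Sg.
exists h; split; first exact: ch.
  by move=> y vy; rewrite (le_trans (hC _ vy))// -natr1 opprD addrAC addrA addrAC.
rewrite (radial_by_parts d rho tau0 v0 dg (symbol_continuous Sg) fC (symbol_bound Sg)).
rewrite normrM normrN exprS -mulrA.
rewrite (_ : (d + 2 * N.+1)%N = (d.+2 + 2 * N)%N); last first.
  by rewrite mulnS addnA addn2.
rewrite ler_pM// ger0_norm ?divr_ge0// ler_pdivrMr//.
by rewrite ler_peMr// ler1n.
Qed.

(** After [N] integrations by parts the Bessel factor decays like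
    [(1 + rho * r) ^- N] and the symbol like [y `^ (be - N)], so the exponential can
    be dropped: the bound is independent of the rate [tau]. *)
Lemma radial_integral_bound N d C be tau v rho (f : R -> R) (Cb : R) :
  (forall w : R, 0 <= w -> (1 + Num.sqrt w) ^+ N * `|bessel_entire (d + 2 * N) w| <= Cb) ->
  0 < rho -> 0 < tau -> 0 < v -> 0 <= C -> d%:R + 2 + 2 * be + 2 <= N%:R ->
  symbol N.+1 C be tau v f ->
  (`|\int[mu]_(r in `]0%R, +oo[) (radial d rho r * f (v + r ^+ 2))|%:E <=
   (2 ^+ N * (Cb * C))%:E * \int[mu]_(r in pos)
     (quad_kernel (d%:R + 2 + 2 * be) (N%:R - be) rho (r, v))%:E)%E.
Proof.
move=> hCb rho0 tau0 v0 C0 eN Sf.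
have Cb0 : 0 <= Cb.
  by apply: le_trans (hCb 0 (lexx _)); rewrite mulr_ge0// exprn_ge0// addr_ge0 ?sqrtr_ge0.
have [h [ch hC hI]] := radial_by_parts_iter d rho tau0 v0 Sf.
have ih := integrable_radial (d + 2 * N) rho tau0 v0 ch hC.
set e := d%:R + 2 + 2 * be in eN *.
have mK : measurable_fun pos (fun r : RM => quad_kernel e (N%:R - be) rho (r, v)).
  apply: continuous_measurable_halfline => r r0; rewrite /quad_kernel /=.
  apply: cvgM; first exact: continuous_pow_kernel.
  apply: cvgM; first exact: continuous_powRp.
  apply: (@continuous_shift _ (fun z : R => z `^ (- (N%:R - be))) v v0) => y y0.
  exact: continuous_powRp.
apply: (@le_trans _ _ ((2 ^+ N)%:E *
    `|\int[mu]_(r in pos) (radial (d + 2 * N) rho r * h (v + r ^+ 2))|%:E)%E).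
  by rewrite -EFinM lee_fin.
rewrite EFinM -muleA; apply: lee_wpmul2l; first by rewrite lee_fin exprn_ge0.
rewrite EFin_normr_Rintegral//.
apply: (@le_trans _ _ (\int[mu]_(r in pos)
    `|(radial (d + 2 * N) rho r * h (v + r ^+ 2))%:E|)%E).
  by apply: le_abse_integral => //; exact: measurable_int ih.
rewrite -ge0_integralZl_EFin//; last 3 first.
- by move=> r _; rewrite lee_fin quad_kernel_ge0.
- exact/measurable_EFinP.
- by rewrite mulr_ge0.
apply: ge0_le_integral => //.
- by apply: measurableT_comp => //; exact: measurable_int ih.
- apply/measurable_EFinP; apply: measurable_funM => //.
move=> r; rewrite /= in_itv/= andbT => r0.
have y0 : 0 < v + r ^+ 2 by rewrite ltr_pwDl// sqr_ge0.
have s0 : 0 < 1 + rho * r by rewrite ltr_pwDl// mulr_ge0 ?ltW.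
rewrite lee_fin normrM.
have h1 : `|radial (d + 2 * N) rho r| <= Cb * (r ^+ (d + 2 * N) * (1 + rho * r) ^- N).
  have := hCb (rho ^+ 2 * r ^+ 2); rewrite mulr_ge0 ?sqr_ge0// => /(_ isT).
  rewrite -exprMn sqrtr_sqr ger0_norm ?mulr_ge0 ?(ltW rho0) ?(ltW r0)// => hb.
  rewrite /radial -exprMn normrM ger0_norm ?exprn_ge0 ?(ltW r0)// mulrCA ler_wpM2l ?exprn_ge0 ?(ltW r0)//.
  by rewrite ler_pdivlMr ?exprn_gt0// mulrC.
have h2 : `|h (v + r ^+ 2)| <= C * (v + r ^+ 2) `^ (- (N%:R - be)).
  apply: le_trans (hC _ _) _; first by rewrite lerDl sqr_ge0.
  rewrite ler_wpM2l// opprB -[leRHS]mulr1 ler_wpM2l ?powR_ge0//.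
  by rewrite -expR0 ler_expR oppr_le0 mulr_ge0 ?sqrtr_ge0// ltW.
apply: le_trans (ler_pM (normr_ge0 _) (normr_ge0 _) h1 h2) _.
rewrite mulrACA ler_wpM2l ?mulr_ge0// /quad_kernel /= mulrA ler_wpM2r ?powR_ge0//.
apply: le_trans (_ : r `^ e * (1 + rho * r) ^- N * r `^ (2 * (N%:R - be - 1)) <= _); last first.
  by rewrite ler_wpM2r ?powR_ge0// pow_kernel_lb.
rewrite mulrAC -powRDp// ler_wpM2r ?invr_ge0 ?exprn_ge0 ?(ltW s0)//.
rewrite -powR_mulrn ?(ltW r0)// le_eqVlt; apply/orP; left; apply/eqP; congr (_ `^ _).
by rewrite natrD natrM /e; ring.
Qed.

(** The integral in [r] is bounded for each [v]; then the dominating kernel is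
    integrated in the opposite order, where its integral is explicit. *)
Lemma radial_double_integral_bound N d be :
  -1 < d%:R + 2 + 2 * be -> d%:R + 2 + 2 * be + 2 <= N%:R ->
  exists2 B : R, 0 <= B & forall C tau rho (f : R -> R -> R),
    0 <= C -> 0 < tau -> 0 < rho ->
    (forall v, 0 < v -> symbol N.+1 C be tau v (f v)) ->
    mu2.-integrable quad (EFin \o (fun p => radial d rho p.1 * f p.2 (p.2 + p.1 ^+ 2))) ->
    `|\int[mu2]_(p in quad) (radial d rho p.1 * f p.2 (p.2 + p.1 ^+ 2))| <=
    C * B * rho `^ (- (d%:R + 3 + 2 * be)).
Proof.
move=> e1 eN.
have [Cb Cb0 hCb] := @bessel_entire_decay R d N.
set e := d%:R + 2 + 2 * be in e1 eN *.
have d0 : 0 <= d%:R :> R by [].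
have c1 : 1 < N%:R - be by move: e1 eN; rewrite /e; lra.
have e10 : 0 < e + 1 by rewrite -ltrBlDr sub0r.
exists (2 ^+ N * Cb / ((e + 1) * (N%:R - be - 1))).
  rewrite mulr_ge0 ?mulr_ge0 ?exprn_ge0 ?(ltW Cb0)//.
  by rewrite invr_ge0 mulr_ge0 ?(ltW e10)// subr_ge0 ltW.
move=> C tau rho f C0 tau0 rho0 Sf iQ.
have [_ <- _ iF] := quad_fubini iQ.
have mp : measurable pos by exact: measurable_itv.
rewrite -lee_fin EFin_normr_Rintegral//.
apply: (le_trans (le_abse_integral mu mp (measurable_int _ iF))).
have [tK1 tK2 mG] := quad_tonelli (measurable_quad_kernel e (N%:R - be) rho0)
  (fun p _ => quad_kernel_ge0 e _ rho p).
apply: (@le_trans _ _ (\int[mu]_(v in pos) ((2 ^+ N * (Cb * C))%:E *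
   \int[mu]_(r in pos) (quad_kernel e (N%:R - be) rho (r, v))%:E))%E).
  apply: ge0_le_integral => //.
  - by apply: measurableT_comp => //; exact: measurable_int iF.
  - by apply: measurable_funeM.
  move=> v; rewrite /= in_itv/= andbT => v0.
  by apply: (@radial_integral_bound N d C be tau) => //; exact: Sf.
rewrite ge0_integralZl_EFin//; last 2 first.
- by move=> v _; apply: integral_ge0 => r _; rewrite lee_fin quad_kernel_ge0.
- by rewrite !mulr_ge0 ?exprn_ge0 ?(ltW Cb0).
rewrite tK2 -tK1 integral_quad_kernel// -EFinM lee_fin le_eqVlt; apply/orP; left; apply/eqP.
rewrite (_ : d%:R + 3 + 2 * be = e + 1); last by rewrite /e; ring.
by field; rewrite !gt_eqF// subr_gt0.
Qed.

End master.

(** * The leading double integral *)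

Section leading_integral.
Context {R : realType}.
Notation mu := (@lebesgue_measure R).
Notation RM := (measurableTypeR R).
Notation pos := (`]0%R, +oo[%classic : set RM).
Notation quad := (`]0%R, +oo[%classic `*` `]0%R, +oo[%classic : set (RM * RM)).
Notation mu2 := (mu \x mu)%E.

Context (d : nat) (s : R) (d0 : (0 < d)%N) (s0 : 0 < s) (s1 : s < 1 / 2).

Definition sqr_sum (p : R * R) : R := p.2 + p.1 ^+ 2.

Definition main_integrand (a rho x : R) (p : R * R) : R :=
  radial d rho p.1 * (p.2 `^ s * (sqr_sum p `^ a * expR (- (x * Num.sqrt (sqr_sum p))))).

Lemma sqr_sum_gt0 p : quad p -> 0 < sqr_sum p.
Proof. by move=> /in_quad[_ v0]; rewrite ltr_pwDl// sqr_ge0. Qed.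

Lemma measurable_radial rho : measurable_fun setT (fun p : RM * RM => radial d rho p.1).
Proof.
apply: (measurableT_comp (f := radial d rho)); last exact: measurable_fst.
exact: continuous_measurable_fun (@continuous_radial R d rho).
Qed.

Lemma measurable_expR_sqrt x :
  measurable_fun setT (fun p : RM * RM => expR (- (x * Num.sqrt (sqr_sum p)))).
Proof.
apply: (measurableT_comp (f := fun z : R => expR (- (x * Num.sqrt z)))); last first.
  exact: measurable_shift.
apply: continuous_measurable_fun => z.
apply: continuous_cvg; first exact: continuous_expR.
by apply: cvgN; apply: cvgMr; exact: sqrt_continuous.
Qed.

Lemma measurable_powRsnd (a : R) :
  measurable_fun setT (fun p : RM * RM => p.2 `^ a).
Proof. by apply: measurable_powRc; exact: measurable_snd. Qed.

Lemma measurable_main_integrand a rho x : measurable_fun setT (main_integrand a rho x : RM * RM -> R).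
Proof.
apply: measurable_funM; first exact: measurable_radial.
apply: measurable_funM; first exact: measurable_powRsnd.
apply: measurable_funM; last exact: measurable_expR_sqrt.
by apply: measurable_powRc; exact: measurable_shift.
Qed.

(** Domination, locally uniform in [x > 0].  The kernel on the right is integrable
    since [3 / 2 - s > 1], and here the bound on [s] enters as convergence of the
    integral in [v] at infinity. *)
Lemma main_integrand_dom a rho x0 : - (3 / 2) <= a -> 0 < x0 ->
  exists2 C : R, 0 <= C & forall x p, x0 <= x -> quad p ->
    `|main_integrand a rho x p| <= C * quad_kernel (d%:R - 1 + 2 * s) (3 / 2 - s) 1 p.
Proof.
move=> a32 x00.
set e := d%:R - 1 + 2 * s; set c := 3 / 2 - s.
have [M eM] : exists M : nat, (2 * a + 3) + (e + 2) <= M%:R.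
  by eexists; rewrite ltW//; exact: le_lt_trans (ler_norm _) (archi_boundP (normr_ge0 _)).
have [C C0 CN] := exp_dominates M x00.
exists C; first exact: ltW.
move=> x p xx /[dup] qp /in_quad[r0 v0].
have y0 := sqr_sum_gt0 qp; set y := sqr_sum p in y0 *.
have q0 : 0 < Num.sqrt y by rewrite sqrtr_gt0.
have rq : p.1 <= Num.sqrt y by apply: le_sqrt_shift; exact: ltW.
have r1 : 0 < 1 + 1 * p.1 by rewrite mul1r addr_gt0.
rewrite /main_integrand normrM [X in _ * X]ger0_norm; last first.
  by rewrite mulr_ge0 ?powR_ge0// mulr_ge0 ?powR_ge0 ?expR_ge0.
have -> : C * quad_kernel e c 1 p =
    p.1 ^+ d * (y `^ s * (y `^ (- (3 / 2)) * (C * (1 + 1 * p.1) `^ (- (e + 2))))).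
  rewrite /quad_kernel pow_kernelE// -/y.
  have -> : y `^ (- c) = y `^ s * y `^ (- (3 / 2)).
    by rewrite -powRDp//; congr (_ `^ _); rewrite /c; ring.
  have -> : p.1 ^+ d = p.1 `^ e * p.1 `^ (2 * (c - 1)).
    rewrite -powRDp// -powR_mulrn ?(ltW r0)//; congr (_ `^ _).
    by rewrite /e /c; field.
  ring.
apply: ler_pM; rewrite ?normr_ge0//.
- by rewrite mulr_ge0 ?powR_ge0// mulr_ge0 ?powR_ge0 ?expR_ge0.
- by apply: radial_le; exact: ltW.
apply: ler_pM; rewrite ?powR_ge0// ?mulr_ge0 ?powR_ge0 ?expR_ge0//.
  apply: ge0_ler_powR; rewrite ?nnegrE ?(ltW s0) ?(ltW v0) ?(ltW y0)//.
  by rewrite lerDl sqr_ge0.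
have -> : y `^ a = y `^ (- (3 / 2)) * y `^ (a + 3 / 2).
  by rewrite -powRDp//; congr (_ `^ _); ring.
rewrite -mulrA ler_wpM2l ?powR_ge0//.
rewrite powRN ler_pdivlMr ?powR_gt0//.
apply: (@le_trans _ _ ((1 + Num.sqrt y) ^+ M * expR (- (x0 * Num.sqrt y)))); last first.
  by apply: CN; exact: ltW.
have q1 : 0 < 1 + Num.sqrt y by rewrite addr_gt0.
have hy : y `^ (a + 3 / 2) = Num.sqrt y `^ (2 * a + 3).
  by rewrite sqrt_powR_half ?(ltW y0)// -powRrM; congr (_ `^ _); field.
rewrite mulrAC; apply: ler_pM; rewrite ?expR_ge0 ?mulr_ge0 ?powR_ge0//; last first.
  by rewrite ler_expR lerN2 ler_wpM2r// ltW.
apply: (@le_trans _ _ ((1 + Num.sqrt y) `^ (2 * a + 3) * (1 + Num.sqrt y) `^ (e + 2))).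
  have e2 : 0 <= e + 2.
    have : 0 <= d%:R :> R by [].
    by rewrite /e; move: s0; lra.
  rewrite hy ler_pM ?powR_ge0//.
    apply: ge0_ler_powR; rewrite ?nnegrE ?(ltW q0) ?(ltW q1)// ?lerDr//.
    by move: a32; lra.
  apply: ge0_ler_powR; rewrite ?nnegrE ?(ltW r1) ?(ltW q1)//.
  by rewrite mul1r lerD2l.
rewrite -powRDp// -powR_mulrn ?(ltW q1)//.
by rewrite ler_powR// lerDl ltW.
Qed.

Lemma dim_exp : -1 < d%:R - 1 + 2 * s.
Proof.
have : 1 <= d%:R :> R by rewrite ler1n.
by move: s0; lra.
Qed.

Lemma decay_exp : 1 < 3 / 2 - s.
Proof. by move: s1; lra. Qed.

Lemma integrable_main_integrand a rho x : - (3 / 2) <= a -> 0 < x ->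
  mu2.-integrable quad (EFin \o main_integrand a rho x).
Proof.
move=> a32 x0; have [C C0 hC] := main_integrand_dom rho a32 x0.
apply: (@integrable_quad_dom _ _ C _ _ 1 ltr01 dim_exp decay_exp).
  by apply: measurable_funTS; exact: measurable_main_integrand.
by move=> p qp; apply: hC.
Qed.

(** [- (3 / 2)] is the exponent [a] of the leading term; the other values appear
    because differentiation in [x] raises [a] by one half. *)
Definition main_integral (a rho x : R) : R := \int[mu2]_(p in quad) main_integrand a rho x p.

Lemma is_derive_main_integrand a rho (x : R) p : quad p ->
  is_derive x 1 (fun z => main_integrand a rho z p) (- main_integrand (a + 2^-1) rho x p).
Proof.
move=> qp; have y0 := sqr_sum_gt0 qp.
rewrite /main_integrand; set y := sqr_sum p in y0 *; set q := Num.sqrt y.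
have h0 : is_derive x 1 (fun z : R => - (z * q)) (- q).
  by apply: is_derive_eq; rewrite /GRing.scale /=; ring.
have h1 := @is_derive1_comp R (@expR R) (fun z : R => - (z * q)) x _ _ (is_derive_expR _) h0.
apply: is_derive_eq; rewrite /GRing.scale /=.
by rewrite powRDp// -sqrt_powR_half ?(ltW y0)// -/q; ring.
Qed.

Lemma is_derive_main_integral a rho (x : R) : - (3 / 2) <= a -> 0 < x ->
  is_derive x 1 (main_integral a rho) (- main_integral (a + 2^-1) rho x).
Proof.
move=> a32 x0.
have a32' : - (3 / 2) <= a + 2^-1 by move: a32; lra.
have x20 : 0 < x / 2 by rewrite divr_gt0.
have [C C0 hC] := main_integrand_dom rho a32' x20.
pose f (z : R) (p : RM * RM) : R := main_integrand a rho z p.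
have Ix : (`](x / 2), (x + 1)[%classic : set R) x.
  by rewrite /= in_itv/=; apply/andP; split; move: x0; lra.
have intf (z : R) : (`](x / 2), (x + 1)[%classic : set R) z -> mu2.-integrable quad (EFin \o f z).
  rewrite /= in_itv/= => /andP[xz _]; apply: integrable_main_integrand => //.
  exact: lt_trans xz.
have derf (z : R) p : (`](x / 2), (x + 1)[%classic : set R) z -> quad p -> derivable (f ^~ p) z 1.
  by move=> _ qp; case: (is_derive_main_integrand a rho z qp).
have d1f (z : R) p : quad p -> partial1of2 f z p = - main_integrand (a + 2^-1) rho z p.
  move=> qp; rewrite partial1of2E.
  by case: (is_derive_main_integrand a rho z qp).
have iG : mu2.-integrable quad (EFin \o (fun p => C * quad_kernel (d%:R - 1 + 2 * s) (3 / 2 - s) 1 p)).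
  apply: (@integrable_quad_dom _ _ C _ _ 1 ltr01 dim_exp decay_exp).
    by apply: measurable_funM => //; exact: measurable_quad_kernel.
  by move=> p qp; rewrite ger0_norm// mulr_ge0// quad_kernel_ge0.
have Gub (z : R) p : (`](x / 2), (x + 1)[%classic : set R) z -> quad p ->
    `|partial1of2 f z p| <= C * quad_kernel (d%:R - 1 + 2 * s) (3 / 2 - s) 1 p.
  rewrite /= in_itv/= => /andP[xz _] qp; rewrite d1f// normrN.
  by apply: hC => //; exact: ltW.
have G0 p : 0 <= C * quad_kernel (d%:R - 1 + 2 * s) (3 / 2 - s) 1 p.
  by rewrite mulr_ge0// quad_kernel_ge0.
split.
  exact: (derivable_under_integral measurable_quad Ix intf derf G0 iG Gub).
rewrite -derive1E.
rewrite (differentiation_under_integral measurable_quad Ix intf derf G0 iG Gub).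
rewrite -mulN1r -RintegralZl//; first last.
- exact: integrable_main_integrand.
- exact: measurable_quad.
by apply: eq_Rintegral => p; rewrite inE => qp; rewrite mulN1r d1f.
Qed.

(** The integral does not converge absolutely at [x = 0], and the uniform bound
    comes from [radial_double_integral_bound]: the integrand is a symbol without
    denominator, of order [a + s]. *)
Lemma main_integral_bounded a : - (3 / 2) <= a ->
  exists2 B : R, 0 <= B & forall x, 0 < x -> `|main_integral a 1 x| <= B.
Proof.
move=> a32.
have d1 : 1 <= d%:R :> R by rewrite ler1n.
(* The order [a + s], in the form in which [symbol_std_symbol] delivers it. *)
pose be := a + 0 / 2 - 0%:R - 0%:R / 2 + s.
have beE : be = a + s by rewrite /be; field.
have e1 : -1 < d%:R + 2 + 2 * be by rewrite beE; move: s0 a32 d1; lra.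
have [N eN] : exists N : nat, d%:R + 2 + 2 * be + 2 <= N%:R.
  by eexists; rewrite ltW//; exact: le_lt_trans (ler_norm _) (archi_boundP (normr_ge0 _)).
have [B B0 hB] := radial_double_integral_bound e1 eN.
(* The denominator occurs with exponent 0; [b = 1] and [kap = 0] make it positive. *)
have k1 : `|0 : R| < 1 by rewrite normr0.
have [C C0 hC] := @symbol_std_symbol R 1 0 N.+1 0 0 0 a k1 (leqnn 0).
exists (C * B); first by rewrite mulr_ge0.
move=> x x0.
have x20 : 0 < x / 2 by rewrite divr_gt0.
pose f (v y : R) := v `^ s * std_symbol 1 0 x 0 0 0 0 a y.
have fE p : main_integrand a 1 x p = radial d 1 p.1 * f p.2 (p.2 + p.1 ^+ 2).
  by rewrite /main_integrand /f /std_symbol !expr0 mulr0n oppr0 powRr0 !mulr1 !mul1r.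
have Sf v : 0 < v -> symbol N.+1 C be (x / 2) v (f v).
  move=> v0; rewrite /be; apply: symbol_powR; rewrite ?(ltW s0)//.
  exact: hC.
have iQ := integrable_main_integrand 1 a32 x0.
have {}fE : main_integrand a 1 x = fun p => radial d 1 p.1 * f p.2 (p.2 + p.1 ^+ 2).
  exact/funext.
rewrite fE in iQ; rewrite /main_integral fE.
by have := hB C _ 1 f C0 x20 ltr01 Sf iQ; rewrite powR1 mulr1.
Qed.

(** The derivative is bounded, by [L] say; adding [L * x] makes the function
    monotone and bounded below, hence convergent. *)
Lemma main_integral_cvg0 a : - (3 / 2) <= a -> cvg (main_integral a 1 x @[x --> 0^'+]).
Proof.
move=> a32.
have a32' : - (3 / 2) <= a + 2^-1 by move: a32; lra.
have [L L0 hL] := main_integral_bounded a32'.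
have [B B0 hB] := main_integral_bounded a32.
pose G x := main_integral a 1 x + L * x.
have dG (x : R) : 0 < x -> is_derive x 1 G (L - main_integral (a + 2^-1) 1 x).
  move=> x0; have h := is_derive_main_integral 1 a32 x0.
  rewrite /G; apply: is_derive_eq; rewrite /GRing.scale /=; ring.
have Gnd (x y : R) : 0 < x -> x <= y -> G x <= G y.
  move=> x0 xy.
  have zp (z : R) : x <= z -> 0 < z by exact: lt_le_trans.
  apply: (@ger0_derive1_le_cc _ G x y) => //.
  - by move=> z; rewrite in_itv/= => /andP[/ltW/zp z0 _]; case: (dG _ z0).
  - move=> z; rewrite in_itv/= => /andP[/ltW/zp z0 _].
    rewrite derive1E; case: (dG _ z0) => _ ->.
    by rewrite subr_ge0 (le_trans (ler_norm _))// hL.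
  - by apply: derivable_within_continuous => z; rewrite in_itv/= => /andP[/zp z0 _]; case: (dG _ z0).
  - by rewrite in_itv/= lexx.
  - by rewrite in_itv/= xy lexx.
have cG : cvg (G x @[x --> 0^'+]).
  apply: nondecreasing_at_right_is_cvgr; near=> b.
    by move=> x y; rewrite !in_itv/= => /andP[x0 _] _; exact: Gnd.
  exists (- B) => _ [x + <-]; rewrite /= in_itv/= => /andP[x0 _].
  rewrite /G (le_trans (_ : _ <= main_integral a 1 x))//.
    by rewrite lerNl (le_trans (ler_norm _))// normrN hB.
  by rewrite lerDl mulr_ge0// ltW.
have -> : main_integral a 1 = (fun x => G x - L * x) by apply/funext => x; rewrite /G addrK.
apply: is_cvgB => //; apply: (cvgP (L * 0)); apply: cvgMr.
by apply: cvg_at_right_filter; exact: cvg_id.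
Unshelve. all: by end_near. Qed.

End leading_integral.

(** * Smoothness up to the origin *)

Section smooth_class.
Context {R : realType}.
Implicit Types f g h : R -> R.

(** Functions of class C^n on the open half-line whose derivatives extend to the
    origin.  The recursion over explicit derivatives makes closure under sums and
    products an induction, without computing iterated derivatives. *)
Fixpoint smooth_to0 (n : nat) f : Prop :=
  cvg (f x @[x --> 0^'+]) /\
  match n with
  | 0 => True
  | n'.+1 => exists2 g, (forall x : R, 0 < x -> is_derive x 1 f (g x)) & smooth_to0 n' g
  end.

Lemma smooth_to0_cvg n f : smooth_to0 n f -> cvg (f x @[x --> 0^'+]).
Proof. by case: n => [|n] []. Qed.

Lemma smooth_to0_deriv n f : smooth_to0 n.+1 f ->
  exists2 g, (forall x : R, 0 < x -> is_derive x 1 f (g x)) & smooth_to0 n g.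
Proof. by case. Qed.

Lemma smooth_to0W n f : smooth_to0 n.+1 f -> smooth_to0 n f.
Proof.
elim: n f => [|n IH] f; first by case.
move=> sf; split; first exact: smooth_to0_cvg sf.
by have [g dg sg] := smooth_to0_deriv sf; exists g => //; exact: IH.
Qed.

Lemma smooth_to0_cst n (c : R) : smooth_to0 n (fun=> c).
Proof.
elim: n c => [|n IH] c; split => //; try exact: is_cvg_cst.
by exists (fun=> 0) => // x _; exact: is_derive_cst.
Qed.

Lemma smooth_to0_id n : smooth_to0 n (fun x : R => x).
Proof.
have c0 : cvg ((fun x : R => x) x @[x --> 0^'+]).
  by apply: (cvgP (0 : R)); apply: cvg_at_right_filter; exact: cvg_id.
case: n => [|n]; split => //.
by exists (fun=> 1); [move=> x _; exact: is_derive_id|exact: smooth_to0_cst].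
Qed.

Lemma smooth_to0D n f g : smooth_to0 n f -> smooth_to0 n g -> smooth_to0 n (fun x => f x + g x).
Proof.
elim: n f g => [|n IH] f g sf sg; split => //.
- by apply: is_cvgD; [exact: smooth_to0_cvg sf|exact: smooth_to0_cvg sg].
- by apply: is_cvgD; [exact: smooth_to0_cvg sf|exact: smooth_to0_cvg sg].
have [f' df sf'] := smooth_to0_deriv sf; have [g' dg sg'] := smooth_to0_deriv sg.
exists (fun x => f' x + g' x); last exact: IH.
by move=> x x0; have h1 := df _ x0; have h2 := dg _ x0; exact: is_deriveD.
Qed.

Lemma smooth_to0M n f g : smooth_to0 n f -> smooth_to0 n g -> smooth_to0 n (fun x => f x * g x).
Proof.
elim: n f g => [|n IH] f g sf sg; split => //.
- by apply: is_cvgM; [exact: smooth_to0_cvg sf|exact: smooth_to0_cvg sg].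
- by apply: is_cvgM; [exact: smooth_to0_cvg sf|exact: smooth_to0_cvg sg].
have [f' df sf'] := smooth_to0_deriv sf; have [g' dg sg'] := smooth_to0_deriv sg.
exists (fun x => f x * g' x + g x * f' x); last first.
  by apply: smooth_to0D; apply: IH => //; exact: smooth_to0W.
by move=> x x0; have h1 := df _ x0; have h2 := dg _ x0; exact: is_deriveM.
Qed.

Lemma smooth_to0_quad_powR n (p : R) : smooth_to0 n (fun x => (1 + x ^+ 2) `^ p).
Proof.
have q0 (x : R) : 0 < 1 + x ^+ 2 by rewrite ltr_pwDl// sqr_ge0.
have c0 (e : R) : cvg ((1 + x ^+ 2) `^ e @[x --> 0^'+]).
  apply: (cvgP ((1 + 0 ^+ 2) `^ e)); apply: cvg_at_right_filter.
  apply: (cvg_comp (fun x : R => 1 + x ^+ 2) (fun z : R => z `^ e)).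
    by apply: cvgD; [exact: cvg_cst|exact: exprn_continuous].
  exact: continuous_powRp.
elim: n p => [|n IH] p; split => //.
exists (fun x => (p * (1 + x ^+ 2) `^ (p - 1)) * (2 * x)).
  move=> x x0; have h1 : is_derive x 1 (fun z : R => 1 + z ^+ 2) (2 * x).
    by apply: is_derive_eq; rewrite /GRing.scale /=; ring.
  exact: (@is_derive1_comp R (fun z : R => z `^ p) (fun z : R => 1 + z ^+ 2) x _ _
    (is_derive1_powR p (q0 x)) h1).
apply: smooth_to0M; apply: smooth_to0M; [exact: smooth_to0_cst|exact: IH| |].
  exact: smooth_to0_cst.
exact: smooth_to0_id.
Qed.

Lemma derive1n_smooth_to0 k f h : smooth_to0 k.+1 f -> (forall x, 0 < x -> h x = f x) ->
  exists2 g, (forall x, 0 < x -> derive1n k h x = g x) & smooth_to0 1 g.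
Proof.
elim: k f h => [|k IH] f h sf hf; first by exists f.
have [g dg sg] := smooth_to0_deriv sf.
rewrite derive1Sn; apply: (IH g) => // x x0.
rewrite derive1E (@near_eq_derive _ _ _ h f)//.
- by case: (dg _ x0).
- by near=> z; apply: hf; near: z; exact: lt_nbhsr.
Unshelve. all: by end_near. Qed.

Lemma smooth_nonneg_smooth_to0 f : (forall n, smooth_to0 n f) ->
  smooth_nonneg (fun x => if 0 < x then f x else lim (f x @[x --> 0^'+])).
Proof.
move=> sf; pose h x := if 0 < x then f x else lim (f x @[x --> 0^'+]).
have hf x : 0 < x -> h x = f x by rewrite /h => ->.
split.
  rewrite ltxx; apply: cvg_trans (smooth_to0_cvg (sf 0%N)).
  by apply: near_eq_cvg; near=> x; rewrite ifT.
move=> k; have [g hg sg] := derive1n_smooth_to0 (sf k.+1) hf.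
have [g' dg _] := smooth_to0_deriv sg.
split.
  move=> x; rewrite in_itv/= andbT => x0.
  apply: (@near_eq_derivable _ _ _ g) => //; last by case: (dg _ x0).
  by near=> z; apply/esym/hg; near: z; exact: lt_nbhsr.
have /cvg_ex[l gl] := smooth_to0_cvg sg.
apply: (cvgP l); apply: cvg_trans gl.
by apply: near_eq_cvg; near=> x; rewrite hg.
Unshelve. all: by end_near. Qed.

End smooth_class.

(** * Scaling of half-line integrals *)

Section scaling.
Context {R : realType}.
Notation mu := (@lebesgue_measure R).
Notation RM := (measurableTypeR R).
Notation pos := (`]0%R, +oo[%classic : set RM).

Lemma measurable_scale (lam : R) : measurable_fun setT (fun x : RM => lam * x : RM).
Proof. by apply: measurable_funM. Qed.

(** Lebesgue measure is [lam] times its image under multiplication by [lam], by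
    uniqueness of the measure with given values on intervals. *)
Lemma ge0_integral_scale (f : R -> \bar R) (lam : R) : 0 < lam ->
  measurable_fun pos f -> (forall x, pos x -> 0 <= f x)%E ->
  (\int[mu]_(x in pos) f x = lam%:E * \int[mu]_(x in pos) f (lam * x)%R)%E.
Proof.
move=> lam0 mf f0.
pose phi (x : RM) : RM := lam * x.
pose k : {nonneg R} := NngNum (ltW lam0).
pose nu0 := (mscale k (pushforward mu phi) : {measure set RM -> \bar R}).
pose nu := nu0 (measurable_scale lam).
have munu A : measurable A -> mu A = nu A.
  apply: lebesgue_measure_unique => X [[a b] _ <-].
  rewrite /nu /nu0 /= /mscale /= /pushforward /=.
  rewrite (_ : _ @^-1` _ = `](lam^-1 * a), (lam^-1 * b)]%classic); last first.
    apply/seteqP; split => x /=; rewrite !in_itv/= ler_pdivlMl// ltr_pdivrMl//.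
  rewrite !lebesgue_measure_itv/= !lte_fin ltr_pM2l ?invr_gt0//.
  case: ifPn => _; last by rewrite mule0.
  by rewrite -!EFinB -EFinM; congr EFin; field; rewrite gt_eqF.
have mp : measurable pos by exact: measurable_itv.
rewrite (eq_measure_integral nu); last by move=> A mA _; exact: munu.
rewrite ge0_integral_mscale//; congr (_ * _)%E.
rewrite (ge0_integral_pushforward (measurable_scale lam))//; last first.
  by move=> x; rewrite inE; exact: f0.
rewrite (_ : _ @^-1` _ = pos)//.
by apply/seteqP; split => x /=; rewrite !in_itv/= !andbT pmulr_rgt0.
Qed.

Lemma Rintegral_scale (f : R -> R) (lam : R) : 0 < lam ->
  mu.-integrable pos (EFin \o f) ->
  \int[mu]_(x in pos) f x = lam * \int[mu]_(x in pos) f (lam * x).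
Proof.
move=> lam0 intf; have mf := measurable_int _ intf.
have fp := ge0_integral_scale lam0 (measurable_funepos mf) (fun x _ => funepos_ge0 _ x).
have fn := ge0_integral_scale lam0 (measurable_funeneg mf) (fun x _ => funeneg_ge0 _ x).
have lamN0 : lam != 0 by rewrite gt_eqF.
rewrite /Rintegral [in LHS]integralE [in RHS]integralE fp fn.
pose A := (\int[mu]_(x in pos) (EFin \o f)^\+ (lam * x)%R)%E.
pose B := (\int[mu]_(x in pos) (EFin \o f)^\- (lam * x)%R)%E.
rewrite -/A in fp *; rewrite -/B in fn *.
have finA : (A \is a fin_num)%E.
  have : (lam%:E * A)%E \is a fin_num by rewrite -fp; exact: integrable_pos_fin_num intf.
  have : (0 <= A)%E by apply: integral_ge0.
  by case: (A) => [r| |]//=; rewrite gt0_muley.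
have finB : (B \is a fin_num)%E.
  have : (lam%:E * B)%E \is a fin_num by rewrite -fn; exact: integrable_neg_fin_num intf.
  have : (0 <= B)%E by apply: integral_ge0.
  by case: (B) => [r| |]//=; rewrite gt0_muley.
transitivity (lam * fine (A - B)%E); last first.
  congr (_ * fine (_ - _)%E); apply: eq_integral => x _.
    by rewrite !funeposE.
  by rewrite !funenegE.
by rewrite -(fineK finA) -(fineK finB) -!EFinM -!EFinB /= mulrBr.
Qed.

End scaling.

(** * The change of variables v = sigma (sigma + 2 r) *)

Section substitution.
Context {R : realType}.
Notation mu := (@lebesgue_measure R).
Notation RM := (measurableTypeR R).
Notation pos := (`]0%R, +oo[%classic : set RM).

Lemma normc_sqr (X th z : R) :
  ComplexField.Normc.normc (X%:C%C * expi th - z%:C%C) ^+ 2 =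
  z ^+ 2 - 2 * cos th * X * z + X ^+ 2.
Proof.
rewrite /expi /= sqr_sqrtr ?addr_ge0 ?sqr_ge0//.
have -> : X ^+ 2 = X ^+ 2 * (cos th ^+ 2 + sin th ^+ 2) by rewrite cos2Dsin2 mulr1.
ring.
Qed.

(** The substitution [sigma = sqrt (v + r ^+ 2) - r], that is
    [v = sigma * (sigma + 2 * r)], which turns the product
    [sigma `^ s * (sigma + 2 * r) `^ s] into the single power [v `^ s]. *)
Lemma integral_subst_shift (r : R) (g : R -> R) : 0 < r ->
  (forall x : R, 0 < x -> {for x, continuous g}) ->
  (g x @[x --> 0^'+] --> g 0) ->
  (forall x : R, 0 < x -> 0 <= g x) ->
  \int[mu]_(x in pos) g x =
  \int[mu]_(v in pos) (g (Num.sqrt (v + r ^+ 2) - r) * (2 * Num.sqrt (v + r ^+ 2))^-1).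
Proof.
move=> r0 cg g0 gge0.
have r20 : 0 < r ^+ 2 by rewrite exprn_gt0.
pose F (v : R) := Num.sqrt (v + r ^+ 2) - r.
pose f (v : R) := (2 * Num.sqrt (v + r ^+ 2))^-1.
have dF (v : R) : 0 <= v -> is_derive v 1 F (f v).
  move=> v0; have y0 : 0 < v + r ^+ 2 by rewrite ltr_wpDl.
  have h1 : is_derive v 1 (fun z : R => z + r ^+ 2) 1.
    by apply: is_derive_eq; rewrite addr0.
  have h2 : is_derive v 1 (fun z : R => Num.sqrt (z + r ^+ 2)) (f v * 1).
    exact: (@is_derive1_comp R (@Num.sqrt R) (fun z : R => z + r ^+ 2) v _ _
      (is_derive1_sqrt y0) h1).
  by apply: is_derive_eq; rewrite mulr1 subr0.
have F'E (v : R) : 0 <= v -> derive1 F v = f v.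
  by move=> v0; rewrite derive1E; case: (dF _ v0).
have F0 : F 0 = 0 by rewrite /F add0r sqrtr_sqr gtr0_norm// subrr.
have cF (v : R) : 0 <= v -> {for v, continuous F}.
  move=> v0; apply/differentiable_continuous/derivable1_diffP.
  by case: (dF _ v0).
have cf (v : R) : 0 <= v -> {for v, continuous f}.
  move=> v0; have y0 : 0 < v + r ^+ 2 by rewrite ltr_wpDl.
  apply: cvgV; first by rewrite mulf_neq0// gt_eqF// sqrtr_gt0.
  apply: cvgMr; apply: continuous_cvg; first exact: sqrt_continuous.
  by apply: cvgD; [exact: cvg_id|exact: cvg_cst].
have Fpos (v : R) : 0 < v -> 0 < F v.
  move=> v0; rewrite subr_gt0 -[ltLHS](gtr0_norm r0) -sqrtr_sqr ltr_sqrt ?addr_gt0//.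
  by rewrite ltrDr.
have sqy : Num.sqrt (v + r ^+ 2) @[v --> +oo] --> +oo.
  apply/cvgryPge => A; near=> v.
  rewrite (le_trans (ler_norm A))// -sqrtr_sqr ler_sqrt ?addr_ge0 ?sqr_ge0//.
  by rewrite ler_wpDr ?sqr_ge0//; near: v; exact: nbhs_pinfty_ge.
have mg : measurable_fun pos g by exact: continuous_measurable_halfline.
pose h (v : R) := g (F v) * f v.
have mh : measurable_fun pos h.
  apply: continuous_measurable_halfline => v v0; apply: cvgM; last exact/cf/ltW.
  by apply: (cvg_comp F g); [exact/cF/ltW|exact/cg/Fpos].
rewrite /Rintegral; congr fine.
rewrite integral_itv_obnd_cbnd; last exact/measurable_EFinP.
rewrite -[X in `[X, +oo[]F0.
rewrite (@increasing_ge0_integration_by_substitutiony _ F g 0).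
- rewrite integral_itv_obnd_cbnd; last exact/measurable_EFinP.
  apply: eq_integral => v; rewrite inE/= in_itv/= andbT => v0.
  by rewrite /GRing.mul /= F'E.
- move=> x y; rewrite !in_itv/= !andbT => x0 y0 xy.
  by rewrite /F ltrD2r ltr_sqrt ?ltrD2r; last exact: ltr_wpDl.
- move=> x; rewrite in_itv/= andbT => x0.
  apply: cvg_trans (_ : f @ x --> derive1 F x); last by rewrite F'E ?(ltW x0)//; exact/cf/ltW.
  apply: near_eq_cvg; near=> z; rewrite F'E// ltW//.
  by near: z; exact: lt_nbhsr.
- apply: (cvgP (f 0)); apply: cvg_trans (_ : f x @[x --> 0^'+] --> f 0).
    by apply: near_eq_cvg; near=> z; rewrite F'E// ltW.
  by apply: cvg_at_right_filter; exact: cf.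
- apply: (cvgP 0); apply: cvg_trans (_ : f x @[x --> +oo] --> 0).
    by apply: near_eq_cvg; near=> z; rewrite F'E.
  have k : (2^-1 * (Num.sqrt (x + r ^+ 2))^-1 : R) @[x --> +oo] --> (2^-1 * 0 : R).
    apply: cvgMr; apply/gtr0_cvgV0 => //.
    by near=> z; rewrite sqrtr_gt0 ltr_wpDl.
  rewrite mulr0 in k; apply: cvg_trans k.
  by apply: near_eq_cvg; near=> z; rewrite /f invfM.
- split.
    by move=> x; rewrite in_itv/= andbT => /ltW/dF[].
  by apply: cvg_at_right_filter; exact: cF.
- by apply: (cvg_comp (fun v : R => Num.sqrt (v + r ^+ 2)) (fun z : R => z - r)) sqy _; exact: cvg_addrr.
- rewrite F0; apply/continuous_within_itvcyP; split => // x.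
  by rewrite in_itv/= andbT; exact: cg.
- by move=> x; rewrite F0 in_itv/= andbT; exact: gge0.
Unshelve. all: by end_near.
Qed.

End substitution.

(** * Homogeneity of the leading integral *)

Section main_and_remainder.
Context {R : realType}.
Notation mu := (@lebesgue_measure R).
Notation RM := (measurableTypeR R).
Notation pos := (`]0%R, +oo[%classic : set RM).
Notation quad := (`]0%R, +oo[%classic `*` `]0%R, +oo[%classic : set (RM * RM)).
Notation mu2 := (mu \x mu)%E.

Lemma integrable_shift_dom (g : R -> R) (C c w : R) : 1 < c -> 0 < w ->
  measurable_fun pos g ->
  (forall v, 0 < v -> `|g v| <= C * (v + w) `^ (- c)) ->
  mu.-integrable pos (EFin \o g).
Proof.
move=> c1 w0 mg gC.
have mw : measurable_fun pos (fun v : R => (v + w) `^ (- c)).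
  apply: measurable_funTS; apply: (measurableT_comp (measurable_powR _)).
  exact: measurable_funD.
apply: (@le_integrable _ _ _ mu _ _ (EFin \o g) (fun v => C%:E * ((v + w) `^ (- c))%:E)%E) => //.
- exact/measurable_EFinP.
- move=> v; rewrite /= in_itv/= andbT => v0.
  by rewrite lee_fin (le_trans (gC _ v0))// ler_norm.
- apply: integrableZl => //; apply/integrableP; split.
    exact/measurable_EFinP.
  under eq_integral do rewrite /= ger0_norm ?powR_ge0//.
  by rewrite integral_powR_shift// ltry.
Qed.

Lemma measurable_section (f : RM * RM -> R) (r : R) :
  measurable_fun setT f -> measurable_fun pos (fun v : RM => f (r, v)).
Proof.
by move=> mf; apply: measurable_funTS; apply: measurableT_comp.
Qed.

Context (d : nat) (s : R) (d0 : (0 < d)%N) (s0 : 0 < s) (s1 : s < 1 / 2).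

(** Substitute [r / rho] for [r] and [v / rho ^+ 2] for [v]: the weight contributes
    [- d], the power of [v] [- 2 s], the power of [y] [- 2 a], the measure [- 3]. *)
Lemma main_integral_scale a rho t : - (3 / 2) <= a -> 0 < rho -> 0 < t ->
  main_integral d s a rho t = rho `^ (- (d%:R + 3 + 2 * s + 2 * a)) * main_integral d s a 1 (t / rho).
Proof.
move=> a32 rho0 t0.
have tr0 : 0 < t / rho by rewrite divr_gt0.
have ri0 : 0 < rho^-1 by rewrite invr_gt0.
have ri20 : 0 < rho^-1 ^+ 2 by rewrite exprn_gt0.
have inner rho' t' r : 0 < t' -> 0 < r ->
    mu.-integrable pos (EFin \o (fun v => main_integrand d s a rho' t' (r, v))).
  move=> t'0 r0; have [C C0 hC] := main_integrand_dom d s0 rho' a32 t'0.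
  apply: (@integrable_shift_dom _ (C * (pow_kernel (d%:R - 1 + 2 * s) 1 r *
     r `^ (2 * (3 / 2 - s - 1)))) (3 / 2 - s) (r ^+ 2)).
  - exact: decay_exp.
  - by rewrite exprn_gt0.
  - by apply: measurable_section; exact: measurable_main_integrand.
  - move=> v v0; apply: le_trans (hC t' (r, v) (lexx _) _) _; first exact/in_quad.
    by rewrite /quad_kernel /= !mulrA.
have [E1 _ i1 _] := quad_fubini (integrable_main_integrand d0 s0 s1 rho a32 t0).
have [E2 _ i2 _] := quad_fubini (integrable_main_integrand d0 s0 s1 1 a32 tr0).
rewrite /main_integral -E1 -E2; apply: etrans (Rintegral_scale ri0 i1) _.
pose k := rho `^ (- (d%:R + 2 * s + 2 * a)).
transitivity (rho^-1 * \int[mu]_(r in pos) (rho ^- 2 * k *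
    \int[mu]_(v in pos) main_integrand d s a 1 (t / rho) (r, v))).
  apply: (congr1 ( *%R rho^-1)); apply: eq_Rintegral => r; rewrite inE/= in_itv/= andbT => r0.
  have rr0 : 0 < rho^-1 * r by rewrite mulr_gt0.
  apply: etrans (Rintegral_scale ri20 (inner rho t _ t0 rr0)) _.
  rewrite -mulrA exprVn; congr (_ * _).
  rewrite -RintegralZl//; last exact: inner.
  apply: eq_Rintegral => v; rewrite inE/= in_itv/= andbT => v0.
  have y0 : 0 < v + r ^+ 2 by rewrite addr_gt0// exprn_gt0.
  rewrite /main_integrand /sqr_sum /radial /=.
  have -> : rho ^- 2 * v + (rho^-1 * r) ^+ 2 = rho ^- 2 * (v + r ^+ 2).
    by rewrite exprMn exprVn mulrDr.
  have ri2 : 0 <= rho ^- 2 by rewrite invr_ge0 sqr_ge0.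
  rewrite sqrtrM// -exprVn sqrtr_sqr (ger0_norm (ltW ri0)).
  rewrite !powRM ?exprn_ge0 ?(ltW ri0) ?(ltW v0) ?(ltW y0)//.
  have -> : rho ^+ 2 * (rho^-1 * r) ^+ 2 = 1 ^+ 2 * r ^+ 2.
    by field; rewrite gt_eqF.
  have -> : (rho^-1 * r) ^+ d = rho ^- d * r ^+ d by rewrite exprMn exprVn.
  have e (z : R) : rho `^ (- (2 * z)) = rho^-1 `^ z * rho^-1 `^ z.
    rewrite -powRDp// -powR_inv1 ?(ltW rho0)// -powRrM; congr (_ `^ _); ring.
  have -> : k = rho ^- d * rho `^ (- (2 * s)) * rho `^ (- (2 * a)).
    by rewrite -powR_invn ?(ltW rho0)// -!powRDp// /k; congr (_ `^ _); ring.
  rewrite !e [t * (_ * _)]mulrA; ring.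
rewrite RintegralZl//.
rewrite !mulrA; congr (_ * _).
rewrite /k -powR_invn ?(ltW rho0)// -powR_inv1 ?(ltW rho0)// -!powRDp//.
congr (_ `^ _); ring.
Qed.

End main_and_remainder.

(** * Splitting off the leading term *)

Section remainder.
Context {R : realType}.
Notation mu := (@lebesgue_measure R).
Notation RM := (measurableTypeR R).
Notation pos := (`]0%R, +oo[%classic : set RM).
Notation quad := (`]0%R, +oo[%classic `*` `]0%R, +oo[%classic : set (RM * RM)).
Notation mu2 := (mu \x mu)%E.

Context (d : nat) (s b kap : R) (d0 : (0 < d)%N) (s0 : 0 < s) (s1 : s < 1 / 2)
  (kb : `|kap| < b).

(** [v `^ s / (sqrt y * Q)] times the exponential, written as a standard symbol in
    [y = v + r ^+ 2] with [X = v `^ s]. *)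
Definition full_factor (t : R) (p : R * R) : R :=
  p.2 `^ s * std_symbol b kap t (p.2 `^ s) 0 0 1 (- 2^-1) (sqr_sum p).

Definition full_integrand (rho t : R) (p : R * R) : R := radial d rho p.1 * full_factor t p.

Let b0 : 0 < b. Proof. exact: le_lt_trans kb. Qed.

Lemma full_factor_bound t (p : R * R) : quad p ->
  `|full_factor t p| <= (denom_gap b kap)^-1 *
    (p.2 `^ s * (sqr_sum p `^ (- (3 / 2)) * expR (- (t * Num.sqrt (sqr_sum p))))).
Proof.
move=> /[dup] qp /in_quad[r0 v0].
have y0 := sqr_sum_gt0 qp; rewrite /full_factor; set y := sqr_sum p in y0 *.
have := @denom_ratio R b kap (p.2 `^ s) y 0 1 kb isT (powR_ge0 _ _) y0.
have D0 := denom_gt0 kb (powR_ge0 p.2 s) y0.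
have dl := denom_gap_gt0 kb.
rewrite expr0 mul1r mul0r sub0r !powR_inv1 ?(ltW dl) ?(ltW D0) ?(ltW y0)// => hD.
rewrite ger0_norm; last first.
  rewrite mulr_ge0 ?powR_ge0// /std_symbol !expr0 !mul1r.
  by rewrite mulr_ge0 ?expR_ge0// mulr_ge0 ?powR_ge0.
rewrite /std_symbol !expr0 !mul1r [leRHS]mulrCA ler_wpM2l ?powR_ge0//.
rewrite mulrA ler_wpM2r ?expR_ge0//.
rewrite (_ : - (3 / 2) = - 2^-1 + - 1); last by field.
by rewrite powRDp// !powR_inv1 ?(ltW D0) ?(ltW y0)// [leRHS]mulrCA ler_wpM2l ?powR_ge0.
Qed.

Lemma measurable_full_factor t : measurable_fun setT (full_factor t : RM * RM -> R).
Proof.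
rewrite /full_factor /std_symbol.
under eq_fun do rewrite !expr0 !mul1r.
apply: measurable_funM; first exact: measurable_powRsnd.
apply: measurable_funM; last exact: measurable_expR_sqrt.
have my : measurable_fun setT (sqr_sum : RM * RM -> R) by exact: measurable_shift.
apply: measurable_funM; first by apply: measurable_powRc.
apply: measurable_powRc; rewrite /denom.
have mX := @measurable_powRsnd R s.
apply: measurable_funD; last exact: measurable_funX.
apply: measurable_funB; first exact: measurable_funM.
apply: measurable_funM; first exact: measurable_funM.
apply: (measurableT_comp (f := @Num.sqrt R)) => //.
exact: continuous_measurable_fun (@sqrt_continuous R).
Qed.

Lemma integrable_full_integrand rho t : 0 < t -> mu2.-integrable quad (EFin \o full_integrand rho t).
Proof.
move=> t0.
have a32 : - (3 / 2) <= - (3 / 2) :> R by [].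
have [C C0 hC] := main_integrand_dom d s0 rho a32 t0.
apply: (@integrable_quad_dom _ _ ((denom_gap b kap)^-1 * C) _ _ 1 ltr01 (dim_exp d0 s0) (decay_exp s1)).
  apply: measurable_funTS; apply: measurable_funM; first exact: measurable_radial.
  exact: measurable_full_factor.
move=> p qp; have D0 := denom_gap_gt0 kb.
rewrite -mulrA; apply: le_trans (ler_wpM2l _ (hC t p (lexx _) qp)); last first.
  by rewrite invr_ge0 ltW.
rewrite /full_integrand normrM /main_integrand [X in _ <= _ * X]normrM [leRHS]mulrCA ler_wpM2l//.
apply: le_trans (full_factor_bound t qp) _; rewrite ler_wpM2l ?invr_ge0 ?(ltW D0)//.
exact: ler_norm.
Qed.

Lemma integrable_full_factor t r : 0 < t -> 0 < r ->
  mu.-integrable pos (EFin \o (fun v => full_factor t (r, v))).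
Proof.
move=> t0 r0; have r20 : 0 < r ^+ 2 by rewrite exprn_gt0.
apply: (@integrable_shift_dom _ _ (denom_gap b kap)^-1 (3 / 2 - s) (r ^+ 2) (decay_exp s1) r20).
  by apply: measurable_section; exact: measurable_full_factor.
move=> v v0; have qp : quad (r, v) by exact/in_quad.
apply: le_trans (full_factor_bound t qp) _.
have y0 := sqr_sum_gt0 qp.
rewrite ler_wpM2l ?invr_ge0 ?(ltW (denom_gap_gt0 kb))//.
rewrite /sqr_sum /= in y0 *.
rewrite opprB powRDp// ler_pM ?powR_ge0 ?mulr_ge0 ?powR_ge0 ?expR_ge0//.
  apply: ge0_ler_powR; rewrite ?nnegrE ?(ltW s0) ?(ltW v0) ?(ltW y0)//.
  by rewrite lerDl ltW.
rewrite -[leRHS]mulr1 ler_wpM2l ?powR_ge0//.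
by rewrite -expR0 ler_expR oppr_le0 mulr_ge0 ?sqrtr_ge0// ltW.
Qed.

(** Difference between [1 / Q] and [1 / (b ^+ 2 * y)], times [b ^+ 2 v `^ s / sqrt y]
    and the exponential: [b ^+ 2 * y - Q] is [X * (2 * kap * sqrt y - X)], and a power
    [X = v `^ s] joins the one already present. *)
Definition rem_factor (t v y : R) : R := v `^ (2 * s) *
  ((2 * kap) * std_symbol b kap t (v `^ s) 0 0 1 (- 1) y +
   (- 1) * std_symbol b kap t (v `^ s) 0 1 1 (- (3 / 2)) y).

Lemma full_integrand_split rho t p : quad p ->
  full_integrand rho t p = b ^- 2 * main_integrand d s (- (3 / 2)) rho t p +
    b ^- 2 * (radial d rho p.1 * rem_factor t p.2 (sqr_sum p)).
Proof.
move=> /[dup] qp /in_quad[r0 v0]; have y0 := sqr_sum_gt0 qp.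
rewrite /full_integrand /full_factor /main_integrand /rem_factor; set y := sqr_sum p in y0 *.
have X0 : 0 <= p.2 `^ s by exact: powR_ge0.
have D0 := denom_gt0 kb X0 y0.
have q0 : 0 < Num.sqrt y by rewrite sqrtr_gt0.
rewrite /std_symbol !expr0 !expr1 !mul1r !powR_inv1 ?(ltW D0) ?(ltW y0)//.
have -> : p.2 `^ (2 * s) = p.2 `^ s * p.2 `^ s by rewrite -powRDp//; congr (_ `^ _); ring.
have -> : y `^ (- 2^-1) = (Num.sqrt y)^-1 by rewrite powRN sqrt_powR_half ?(ltW y0).
have -> : y `^ (- (3 / 2)) = (Num.sqrt y)^-1 * y^-1.
  rewrite (_ : - (3 / 2) = - 2^-1 + - 1); last by field.
  by rewrite powRDp// powR_inv1 ?(ltW y0)// powRN sqrt_powR_half ?(ltW y0).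
rewrite /denom in D0 *.
set X := p.2 `^ s in D0 *; set q := Num.sqrt y in q0 D0 *.
have yE : y = q ^+ 2 by rewrite sqr_sqrtr ?ltW.
rewrite yE in D0 *.
by field; rewrite exprMn !gt_eqF.
Qed.

(** Both parts of [rem_factor] are symbols of order [- 2] times [v `^ (2 * s)], hence
    of order [2 s - 2], while the leading term has order [s - 3 / 2]. *)
Lemma remainder_bound : exists2 C : R, 0 <= C & forall rho t, 0 < rho -> 0 < t ->
  `|\int[mu2]_(p in quad) full_integrand rho t p - b ^- 2 * main_integral d s (- (3 / 2)) rho t| <=
  C * rho `^ (- (d%:R - 1 + 4 * s)).
Proof.
have d1 : 1 <= d%:R :> R by rewrite ler1n.
have a32 : - (3 / 2) <= - (3 / 2) :> R by [].
pose be : R := -2 + 2 * s.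
have e1 : -1 < d%:R + 2 + 2 * be by rewrite /be; move: s0 d1; lra.
have [N eN] : exists N : nat, d%:R + 2 + 2 * be + 2 <= N%:R.
  by eexists; rewrite ltW//; exact: le_lt_trans (ler_norm _) (archi_boundP (normr_ge0 _)).
have [B B0 hB] := radial_double_integral_bound e1 eN.
have [C1 C10 h1] := @symbol_std_symbol R b kap N.+1 0 0 1 (- 1) kb isT.
have [C2 C20 h2] := @symbol_std_symbol R b kap N.+1 0 1 1 (- (3 / 2)) kb isT.
pose C := `|2 * kap| * C1 + `|-1 : R| * C2.
have C0 : 0 <= C by rewrite addr_ge0 ?mulr_ge0.
exists (b ^- 2 * (C * B)).
  by rewrite mulr_ge0 ?mulr_ge0// invr_ge0 sqr_ge0.
move=> rho t rho0 t0.
have b2 : b ^- 2 != 0 by rewrite invr_eq0 expf_neq0// gt_eqF.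
have ifull := integrable_full_integrand rho t0.
have imain := integrable_main_integrand d0 s0 s1 rho a32 t0.
pose rem (p : R * R) := radial d rho p.1 * rem_factor t p.2 (p.2 + p.1 ^+ 2).
have remE p : quad p -> rem p = b ^+ 2 * full_integrand rho t p - main_integrand d s (- (3 / 2)) rho t p.
  move=> qp; rewrite (full_integrand_split _ _ qp) /rem -/(sqr_sum p).
  by field; rewrite gt_eqF.
have mq := @measurable_quad R.
have ibf : mu2.-integrable quad (EFin \o (fun p => b ^+ 2 * full_integrand rho t p)).
  rewrite (_ : _ \o _ = (fun p => (b ^+ 2)%:E * (full_integrand rho t p)%:E)%E)//.
  exact: integrableZl.
have irem : mu2.-integrable quad (EFin \o rem).
  apply: (eq_integrable mq (EFin \o (fun p => b ^+ 2 * full_integrand rho t p -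
      main_integrand d s (- (3 / 2)) rho t p))).
    by move=> p; rewrite inE => qp /=; rewrite remE.
  rewrite (_ : _ \o _ = (fun p => (b ^+ 2 * full_integrand rho t p)%:E -
    (main_integrand d s (- (3 / 2)) rho t p)%:E)%E)//.
  exact: integrableB.
have irE : \int[mu2]_(p in quad) rem p =
    b ^+ 2 * \int[mu2]_(p in quad) full_integrand rho t p - main_integral d s (- (3 / 2)) rho t.
  rewrite -RintegralZl// -RintegralB//.
  by apply: eq_Rintegral => p; rewrite inE => qp; rewrite remE.
have -> : \int[mu2]_(p in quad) full_integrand rho t p - b ^- 2 * main_integral d s (- (3 / 2)) rho t =
    b ^- 2 * \int[mu2]_(p in quad) rem p.
  by rewrite irE; field; rewrite gt_eqF.
have Sf v : 0 < v -> symbol N.+1 C be (t / 2) v (rem_factor t v).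
  move=> v0; rewrite /be; apply: symbol_powR => //; first by rewrite mulr_ge0 ?(ltW s0).
  have := h1 t (v `^ s) v t0 (powR_ge0 _ _) v0.
  have := h2 t (v `^ s) v t0 (powR_ge0 _ _) v0.
  rewrite (_ : - (3 / 2) + 1 / 2 - 1 - 0 / 2 = -2); last by field.
  rewrite (_ : - 1 + 0 / 2 - 1 - 0 / 2 = -2); last by field.
  by move=> S2 S1; apply: symbolD; apply: symbolZ.
have t20 : 0 < t / 2 by rewrite divr_gt0.
have := hB C _ rho (rem_factor t) C0 t20 rho0 Sf irem.
rewrite (_ : d%:R + 3 + 2 * be = d%:R - 1 + 4 * s); last by rewrite /be; ring.
move=> hR; rewrite normrM ger0_norm ?invr_ge0 ?sqr_ge0// -mulrA ler_wpM2l ?invr_ge0 ?sqr_ge0//.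
Qed.

End remainder.

(** * Reduction of I_s to a quadrant integrand *)

Section assembly.
Context {R : realType}.
Notation mu := (@lebesgue_measure R).
Notation RM := (measurableTypeR R).
Notation pos := (`]0%R, +oo[%classic : set RM).
Notation quad := (`]0%R, +oo[%classic `*` `]0%R, +oo[%classic : set (RM * RM)).
Notation mu2 := (mu \x mu)%E.

(** Coefficient of the cross term in the squared modulus; it is the one place
    where the sign of [xn] enters. *)
Definition kappa (b s xn : R) : R := Num.sg xn * b * cos (pi * s).

Lemma sin_pis_gt0 (s : R) : 0 < s -> s < 1 / 2 -> 0 < sin (pi * s).
Proof.
move=> s0 s1; apply: sin_gt0_pi; apply/andP; split.
  by rewrite mulr_gt0// pi_gt0.
by rewrite gtr_pMr ?pi_gt0//; move: s1; lra.
Qed.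

Lemma kappa_lt (b s xn : R) : 0 < b -> 0 < s -> s < 1 / 2 -> xn != 0 ->
  `|kappa b s xn| < b.
Proof.
move=> b0 s0 s1 xn0.
rewrite /kappa !normrM normr_sg xn0 mul1r (gtr0_norm b0) gtr_pMr//.
rewrite -(@ltr_pXn2r _ 2)// ?nnegrE// expr1n real_normK ?num_real//.
rewrite cos2sin2 ltrBlDr ltrDl exprn_gt0//.
exact: sin_pis_gt0.
Qed.

(** Expand the squared modulus and substitute; [sigma + r] becomes [sqrt (v + r ^+ 2)],
    which is why the factor [expR (- r * `|xn|)] is exactly what completes the
    exponential. *)
Lemma Is_integral (b s r xn : R) : 0 < b -> 0 < s -> s < 1 / 2 -> 0 < r -> xn != 0 ->
  expR (- r * `|xn|) * Is b s r xn =
  2 * pi * sin (pi * s) *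
    \int[mu]_(v in pos) full_factor s b (kappa b s xn) `|xn| (r, v).
Proof.
move=> b0 s0 s1 r0 xn0; set t := `|xn|; set kap := kappa b s xn.
have t0 : 0 < t by rewrite normr_gt0.
have kb : `|kap| < b by exact: kappa_lt.
have sn0 := sin_pis_gt0 s0 s1; set S := sin (pi * s) in sn0 *.
pose X (z : R) := z `^ s * (z + 2 * r) `^ s.
pose D (z : R) := b ^+ 2 * (z + r) ^+ 2 - 2 * kap * X z * (z + r) + X z ^+ 2.
pose g (z : R) := S * (expR (- (t * z)) * X z / D z).
have X0 (z : R) : 0 <= X z by rewrite mulr_ge0 ?powR_ge0.
have Dq (z : R) : 0 <= z -> D z = denom b kap (X z) ((z + r) ^+ 2).
  move=> z0; rewrite /denom sqrtr_sqr ger0_norm//.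
  by rewrite addr_ge0 ?(ltW r0).
have D0 (z : R) : 0 <= z -> 0 < D z.
  by move=> z0; rewrite Dq// denom_gt0// exprn_gt0// ltr_wpDl.
have IsE : Is b s r xn = 4 * pi * \int[mu]_(z in pos) g z.
  rewrite /Is; congr (_ * _); apply: eq_Rintegral => z.
  rewrite inE/= in_itv/= andbT => z0.
  have -> : (Num.sg xn * b * (z + r)) = Num.sg xn * (b * (z + r)) by rewrite mulrA.
  rewrite normc_sqr -/(X z) exprMn sqr_sg xn0 mul1r exprMn.
  rewrite /g /D -/t mulNr /kap /kappa -!mulrA; congr (S * (_ * (_ * (_ / _)))).
  ring.
have cX (z : R) : 0 < z -> {for z, continuous X}.
  move=> z0; apply: cvgM; first exact: continuous_powRp.
  apply: (cvg_comp (fun z : R => z + 2 * r) (fun z : R => z `^ s)).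
    by apply: cvgD; [exact: cvg_id|exact: cvg_cst].
  by apply: continuous_powRp; rewrite addr_gt0 ?mulr_gt0.
have X00 : X 0 = 0 by rewrite /X powR0 ?mul0r// gt_eqF.
have cX0 : X z @[z --> 0^'+] --> X 0.
  rewrite X00 -[Y in _ --> Y](mul0r ((0 + 2 * r) `^ s)); apply: cvgM; first exact: powR_cvg0.
  apply: cvg_at_right_filter.
  apply: (cvg_comp (fun z : R => z + 2 * r) (fun z : R => z `^ s)).
    by apply: cvgD; [exact: cvg_id|exact: cvg_cst].
  by apply: continuous_powRp; rewrite add0r mulr_gt0.
have cgF (F : set_system R) (FF : Filter F) (z : R) : 0 <= z -> F --> z ->
    X x @[x --> F] --> X z -> g x @[x --> F] --> g z.
  move=> z0 Fz FX.
  have Fzr : x + r @[x --> F] --> z + r by apply: cvgD => //; exact: cvg_cst.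
  apply: cvgMr; apply: cvgM.
    apply: cvgM => //; apply: continuous_cvg; first exact: continuous_expR.
    by apply: cvgN; apply: cvgMr.
  apply: cvgV; first by rewrite gt_eqF// D0.
  apply: cvgD; last by apply: (cvg_comp X (fun z : R => z ^+ 2) FX); exact: exprn_continuous.
  apply: cvgB.
    by apply: cvgMr; apply: (cvg_comp _ (fun z : R => z ^+ 2) Fzr); exact: exprn_continuous.
  by apply: cvgM => //; apply: cvgMr.
rewrite IsE (@integral_subst_shift _ r g r0); last 3 first.
- by move=> z z0; apply: cgF; [exact: ltW|exact: cvg_id|exact: cX].
- by apply: cgF => //; apply: cvg_at_right_filter; exact: cvg_id.
- move=> z z0; apply: mulr_ge0; first exact: ltW.
  by apply: divr_ge0; [rewrite mulr_ge0// expR_ge0|exact/ltW/D0/ltW].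
rewrite (eq_Rintegral mu (g := fun v => S / 2 * expR (r * t) * full_factor s b kap t (r, v))); last first.
  move=> v; rewrite inE/= in_itv/= andbT => v0.
  have r20 : 0 < r ^+ 2 by rewrite exprn_gt0.
  have y0 : 0 < v + r ^+ 2 by rewrite addr_gt0.
  set q := Num.sqrt (v + r ^+ 2).
  have q0 : 0 < q by rewrite sqrtr_gt0.
  have qE : q ^+ 2 = v + r ^+ 2 by rewrite sqr_sqrtr ?ltW.
  have rq : 0 <= q - r by rewrite subr_ge0 le_sqrt_shift// ltW.
  have XE : X (q - r) = v `^ s.
    rewrite /X -powRM//; last by rewrite addr_ge0// mulr_ge0 ?(ltW r0).
    by congr (_ `^ _); rewrite (_ : v = q ^+ 2 - r ^+ 2); [ring|rewrite qE; ring].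
  rewrite /full_factor /std_symbol /sqr_sum /= /g Dq// XE subrK qE -/q !expr0 !mul1r.
  have Dv0 : 0 < denom b kap (v `^ s) (v + r ^+ 2).
    by apply: denom_gt0 => //; exact: powR_ge0.
  rewrite powR_inv1 ?(ltW Dv0)// powRN -sqrt_powR_half ?(ltW y0)// -/q.
  have -> : expR (- (t * (q - r))) = expR (r * t) * expR (- (t * q)).
    by rewrite -expRD; congr expR; ring.
  by field; rewrite !gt_eqF.
rewrite RintegralZl//; last exact: integrable_full_factor.
have -> : expR (- r * t) = (expR (r * t))^-1 by rewrite mulNr expRN.
have e0 := expR_gt0 (r * t).
by field; rewrite gt_eqF.
Qed.

End assembly.

(** * The Bessel integral as a double integral *)

Section double_integral.
Context {R : realType}.
Notation mu := (@lebesgue_measure R).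
Notation RM := (measurableTypeR R).
Notation pos := (`]0%R, +oo[%classic : set RM).
Notation quad := (`]0%R, +oo[%classic `*` `]0%R, +oo[%classic : set (RM * RM)).
Notation mu2 := (mu \x mu)%E.

Context (d : nat) (b s : R) (d0 : (0 < d)%N) (b0 : 0 < b) (s0 : 0 < s)
  (s1 : s < 1 / 2).

(** Differentiation in [x] stays in the family [main_integral d s _ 1]. *)
Lemma smooth_to0_main_integral n (a : R) : - (3 / 2) <= a -> smooth_to0 n (main_integral d s a 1).
Proof.
elim: n a => [|n IH] a a32; first by split => //; exact: main_integral_cvg0.
split; first exact: main_integral_cvg0.
exists (fun x => (-1) * main_integral d s (a + 2^-1) 1 x).
  by move=> x x0; rewrite mulN1r; exact: is_derive_main_integral.
apply: smooth_to0M; first exact: smooth_to0_cst.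
by apply: IH; apply: le_trans a32 _; rewrite lerDl.
Qed.

Definition bessel_const : R :=
  2 `^ (- ((d%:R - 1) / 2)) / Gamma ((d%:R - 1) / 2 + 1) *
  (2 * pi * sin (pi * s)).

(** The powers of [r] combine to [r ^+ d], since [(d - 1) / 2 + (d + 1) / 2 = d], and
    the power of [rho] from the Bessel function cancels the prefactor. *)
Lemma bessel_integralE (rho xn : R) : 0 < rho -> xn != 0 ->
  1 / rho `^ ((d%:R - 1) / 2) * \int[mu]_(r in `]0%R, +oo[)
    (besselJ ((d%:R - 1) / 2) (r * rho) * r `^ ((d%:R + 1) / 2) *
     expR (- r * `|xn|) * Is b s r xn) =
  bessel_const * \int[mu2]_(p in quad) full_integrand d s b (kappa b s xn) rho `|xn| p.
Proof.
move=> rho0 xn0; set t := `|xn|; set kap := kappa b s xn; set nu := (d%:R - 1) / 2.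
have t0 : 0 < t by rewrite normr_gt0.
have kb : `|kap| < b by exact: kappa_lt.
have [<- _ i1 _] := quad_fubini (integrable_full_integrand d0 s0 s1 kb rho t0).
rewrite -RintegralZl//.
transitivity (1 / rho `^ nu * \int[mu]_(r in pos) (rho `^ nu * (bessel_const *
    \int[mu]_(v in pos) full_integrand d s b kap rho t (r, v)))); last first.
  rewrite RintegralZl//; last first.
    rewrite (_ : _ \o _ = (fun r => bessel_const%:E *
      (\int[mu]_(v in pos) full_integrand d s b kap rho t (r, v))%:E)%E)//.
    exact: integrableZl.
  by rewrite mulrA mul1r mulVf ?mul1r// gt_eqF// powR_gt0.
apply: (congr1 ( *%R (1 / rho `^ nu))); apply: eq_Rintegral => r; rewrite inE/= in_itv/= andbT => r0.
have rr0 : 0 < r * rho by rewrite mulr_gt0.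
rewrite besselJE// -/nu -[_ * _ * expR _ * _]mulrA Is_integral// -/kap -/t.
have -> : \int[mu]_(v in pos) full_integrand d s b kap rho t (r, v) =
    radial d rho r * \int[mu]_(v in pos) full_factor s b kap t (r, v).
  by rewrite -RintegralZl//; exact: integrable_full_factor.
rewrite /bessel_const -/nu /radial /=.
have -> : (r * rho) ^+ 2 = rho ^+ 2 * r ^+ 2 by rewrite exprMn mulrC.
have -> : (r * rho / 2) `^ nu = r `^ nu * rho `^ nu * 2 `^ (- nu).
  by rewrite !powRM ?(ltW r0) ?(ltW rho0) ?(ltW rr0)// -powR_inv1// -powRrM mulN1r.
have -> : r ^+ d = r `^ nu * r `^ ((d%:R + 1) / 2).
  by rewrite -powRDp// -powR_mulrn ?(ltW r0)//; congr (_ `^ _); rewrite /nu; field.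
by ring.
Qed.
End double_integral.

(** * The profile and the expansion *)

Section endgame.
Context {R : realType}.

Lemma enorm_gt0 m (u : 'rV[R]_m) : u != 0 -> 0 < enorm u.
Proof.
move=> u0; rewrite /enorm sqrtr_gt0 lt_neqAle sumr_ge0 ?andbT; last first.
  by move=> i _; exact: sqr_ge0.
rewrite eq_sym; apply: contra_neq u0 => /psumr_eq0P u0.
apply/rowP => i; rewrite mxE; apply/eqP.
by rewrite -(@sqrf_eq0 _ (u ord0 i)) u0// => j _; exact: sqr_ge0.
Qed.

Context (d : nat) (b s : R) (d0 : (0 < d)%N) (b0 : 0 < b) (s0 : 0 < s)
  (s1 : s < 1 / 2).

(** The factor [(1 + x ^+ 2) `^ _] converts powers of [rho] into powers of the full
    distance to the origin, [rho * sqrt (1 + x ^+ 2)] for [x = |xn| / rho]. *)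
Definition profile (x : R) : R :=
  bessel_const d s * b ^- 2 * (1 + x ^+ 2) `^ ((d%:R + 2 * s) / 2) *
  main_integral d s (- (3 / 2)) 1 x.

Lemma smooth_to0_profile n : smooth_to0 n profile.
Proof.
apply: smooth_to0M; last exact: smooth_to0_main_integral.
by apply: smooth_to0M; [exact: smooth_to0_cst|exact: smooth_to0_quad_powR].
Qed.

Lemma profileE (rho xn : R) : 0 < rho -> xn != 0 ->
  profile (`|xn| / rho) / (xn ^+ 2 + rho ^+ 2) `^ ((d%:R + 2 * s) / 2) =
  bessel_const d s * (b ^- 2 * main_integral d s (- (3 / 2)) rho `|xn|).
Proof.
move=> rho0 xn0; have t0 : 0 < `|xn| by rewrite normr_gt0.
have a32 : - (3 / 2) <= - (3 / 2) :> R by [].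
rewrite (main_integral_scale d0 s0 s1 a32 rho0 t0) /profile -(real_normK (num_real xn)).
set x := `|xn| / rho; set p := (d%:R + 2 * s) / 2.
have x1 : 0 < 1 + x ^+ 2 by rewrite ltr_wpDr ?sqr_ge0.
have -> : `|xn| ^+ 2 + rho ^+ 2 = rho ^+ 2 * (1 + x ^+ 2).
  by rewrite /x; field; rewrite gt_eqF.
have -> : rho `^ (- (d%:R + 3 + 2 * s + 2 * - (3 / 2))) = ((rho ^+ 2) `^ p)^-1.
  rewrite -powRN -powR_mulrn ?(ltW rho0)// -powRrM; congr (_ `^ _).
  by rewrite /p; field.
rewrite powRM ?sqr_ge0 ?(ltW x1)//.
have h1 : 0 < (rho ^+ 2) `^ p by rewrite powR_gt0// exprn_gt0.
have h2 : 0 < (1 + x ^+ 2) `^ p by rewrite powR_gt0.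
by field; rewrite !gt_eqF.
Qed.

(** [kappa] takes only two values, one for each sign of [xn]. *)
Lemma remainder_bound_sg : exists2 C : R, 0 <= C &
  forall rho xn : R, 0 < rho -> xn != 0 ->
  `| \int[(@lebesgue_measure R \x @lebesgue_measure R)%E]_(p in
       `]0%R, +oo[%classic `*` `]0%R, +oo[%classic)
       full_integrand d s b (kappa b s xn) rho `|xn| p -
     b ^- 2 * main_integral d s (- (3 / 2)) rho `|xn| |
  <= C * rho `^ (- (d%:R - 1 + 4 * s)).
Proof.
have p1 : 1 != 0 :> R by [].
have n1 : -1 != 0 :> R by rewrite oppr_eq0.
have [Cp Cp0 hp] := remainder_bound d0 s0 s1 (kappa_lt b0 s0 s1 p1).
have [Cn Cn0 hn] := remainder_bound d0 s0 s1 (kappa_lt b0 s0 s1 n1).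
exists (Cp + Cn) => [|rho xn rho0 xn0]; first exact: addr_ge0.
have t0 : 0 < `|xn| by rewrite normr_gt0.
case: (ltrgt0P xn) xn0 => // sxn _ in t0 *.
- have -> : kappa b s xn = kappa b s 1 by rewrite /kappa !gtr0_sg.
  apply: le_trans (hp _ _ rho0 sxn) _.
  by rewrite ler_wpM2r ?powR_ge0// lerDl.
- have -> : kappa b s xn = kappa b s (-1).
    by rewrite /kappa !ltr0_sg// oppr_lt0.
  have sxn' : 0 < - xn by rewrite oppr_gt0.
  apply: le_trans (hn _ _ rho0 sxn') _.
  by rewrite ler_wpM2r ?powR_ge0// lerDr.
Qed.

Lemma powRN_le_sum (e M rho t : R) : 0 <= e -> 0 < rho -> 0 < t -> t / rho <= M ->
  rho `^ (- e) <= (1 + M) `^ e * (1 / (t + rho) `^ e).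
Proof.
move=> e0 rho0 t0 tM; have tr0 : 0 < t + rho by rewrite addr_gt0.
have M0 : 0 < 1 + M.
  by apply: ltr_wpDr => //; apply: le_trans tM; rewrite ltW// divr_gt0.
rewrite div1r powRN ler_pdivlMr ?powR_gt0// mulrC ler_pdivrMr ?powR_gt0//.
rewrite -powRM ?(ltW M0) ?(ltW rho0)//; apply: ge0_ler_powR; rewrite ?nnegrE//.
- exact: ltW.
- by rewrite mulr_ge0// ltW.
- by rewrite mulrDl mul1r addrC lerD2l -ler_pdivrMr.
Qed.

End endgame.

Theorem proposition4p5 (R : realType) (n : nat) (b s : R)
    (hn : (3 <= n)%N) (hb : 0 < b) (hs0 : 0 < s) (hs1 : s < 1 / 2)
    (hs : irrational s) :
  exists Kplus Kminus : R -> R,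
    [/\ smooth_nonneg Kplus, smooth_nonneg Kminus &
    forall M : R, exists C delta : R, 0 < delta /\
      forall (x' : 'rV[R]_(n.-1)) (xn : R),
        x' != 0 -> xn != 0 ->
        `|xn| / enorm x' <= M ->
        `|xn| + enorm x' < delta ->
        `| 1 / enorm x' `^ ((n%:R - 3) / 2)
             * \int[lebesgue_measure]_(r in `]0%R, +oo[)
                 (besselJ ((n%:R - 3) / 2) (r * enorm x')
                  * r `^ ((n%:R - 1) / 2) * expR (- r * `|xn|)
                  * Is b s r xn)
           - (if 0 < xn then Kplus else Kminus) (`|xn| / enorm x')
             / (xn ^+ 2 + enorm x' ^+ 2) `^ ((n%:R - 2 + 2 * s) / 2) |
        <= C * (1 / (`|xn| + enorm x') `^ (n%:R - 3 + 4 * s))].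
Proof.
case: n hn => [|[|d]]// d0; rewrite ltnS ltnS in d0.
have d1 : 1 <= d%:R :> R by rewrite ler1n.
have -> : d.+2%:R - 3 = d%:R - 1 :> R by rewrite -addn2 natrD; ring.
have -> : d.+2%:R - 1 = d%:R + 1 :> R by rewrite -addn2 natrD; ring.
have -> : d.+2%:R - 2 = d%:R :> R by rewrite -addn2 natrD; ring.
pose K := profile d b s.
pose K0 x := if 0 < x then K x else lim (K x @[x --> 0^'+]).
have sK : smooth_nonneg K0.
  by apply: smooth_nonneg_smooth_to0 => k; exact: smooth_to0_profile.
have [C C0 hC] := remainder_bound_sg d0 hb hs0 hs1.
exists K0, K0; split => // M.
pose e := d%:R - 1 + 4 * s; have e0 : 0 <= e by rewrite /e; move: hs0 d1; lra.
exists (`|bessel_const d s| * (C * (1 + M) `^ e)), 1; split => // x' xn x'0 xn0 xM _.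
have rho0 := enorm_gt0 x'0; set rho := enorm x' in rho0 xM *.
have t0 : 0 < `|xn| by rewrite normr_gt0.
have -> : (if 0 < xn then K0 else K0) (`|xn| / rho) = K (`|xn| / rho).
  by rewrite if_same /K0 divr_gt0.
rewrite /K profileE// bessel_integralE//.
rewrite -mulrBr normrM -mulrA ler_wpM2l//.
apply: le_trans (hC _ _ rho0 xn0) _.
by rewrite -mulrA ler_wpM2l// powRN_le_sum.
Qed.
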